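(* If $\alpha$ is a composition of $n$ obtained by shuffling a partition and $(1^k)$ for some $k \ge 0$, then the $H_n(0)$-module $X_\alpha$ has a distinguished filtration with respect to $\{\hat{\mathcal{S}}_\beta \mid \beta \models n\}$.
   Context: Let $n$ be a nonnegative integer. A composition $\alpha=(\alpha_1,\dots,\alpha_l)$ of $n$ (written $\alpha\models n$) is a finite sequence of positive integers with sum $n$; $\mathrm{set}(\alpha)=\{\alpha_1,\alpha_1+\alpha_2,\dots,\alpha_1+\cdots+\alpha_{l-1}\}\subseteq[n-1]$, and $\mathrm{comp}$ denotes the inverse bijection from subsets of $[n-1]$ to compositions of $n$. A composition is obtained by shuffling a partition $\lambda$ and $(1^k)$ if it is an interleaving of the sequence $\lambda$ (in its weakly decreasing order) with $k$ ones. The composition diagram of $\alpha$ consists of left-justified rows with $\alpha_i$ cells in the $i$th row from the bottom; $(i,j)$ denotes the cell in the $i$th row from the bottom and $j$th column from the left. 0-Hecke algebra. $H_n(0)$ is the associative unital $\mathbb C$-algebra generated by $\pi_1,\dots,\pi_{n-1}$ with relations $\pi_i^2=\pi_i$, $\pi_i\pi_{i+1}\pi_i=\pi_{i+1}\pi_i\pi_{i+1}$, and $\pi_i\pi_j=\pi_j\pi_i$ for $|i-j|\ge2$. Modules are finitely generated left modules. Its irreducible modules are the one-dimensional $\mathbf F_\alpha=\mathbb C v_\alpha$ ($\alpha\models n$) with $\pi_i v_\alpha=0$ if $i\in\mathrm{set}(\alpha)$ and $\pi_i v_\alpha=v_\alpha$ otherwise. The fundamental quasisymmetric function is $F_\alpha=\sum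 x_{i_1}\cdots x_{i_n}$ over $1\le i_1\le\cdots\le i_n$ with $i_j<i_{j+1}$ whenever $j\in\mathrm{set}(\alpha)$. The quasisymmetric characteristic $\mathrm{ch}$ sends the class $[\mathbf F_\alpha]$ in the Grothendieck group to $F_\alpha$ and is additive on short exact sequences. $\mathrm{QSym}_n$ is the span of $\{F_\alpha\mid\alpha\models n\}$. Young quasisymmetric Schur functions. A standard Young composition tableau of shape $\beta\models n$ is a filling $T$ of the composition diagram of $\beta$ with each of $1,\dots,n$ appearing once such that rows increase from left to right, the first column increases from bottom to top, and for cells $(i,k+1),(j,k)$ with $i<j$: if $T(i,k+1)\ge T(j,k)$ then $(j,k+1)$ is a cell and $T(i,k+1)>T(j,k+1)$. $\mathrm{SYCT}(\beta)$ is the set of these. $\hat{\mathcal S}_\beta:=\sum_{T\in\mathrm{SYCT}(\beta)}F_{\mathrm{comp}(\mathrm{Des}(T))}$, where $\mathrm{Des}(T)=\{i\in[n-1]\mid i\text{ is weakly to the right of }i+1\text{ in }T\}$ (column-wise). $\{\hat{\mathcal S}_\beta\mid\beta\models n\}$ is a basis of $\mathrm{QSym}_n$. The module $X_\alpha$. A standard extended tableau of shape $\alpha$ is a filling of the composition diagram of $\alpha$ with $1,\dots,n$, each once, whose rows increase from left to right and all of whose columns increase from bottom to top; $\mathrm{SET}(\alpha)$ is the set of these. $X_\alpha$ is the $\mathbb C$-span of $\mathrm{SET}(\alpha)$ with action, for $1\le i\le n-1$: $\pi_i\cdot T=T$ if $i$ is strictly left of $i+1$ in $T$; $\pi_i\cdot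 T=0$ if $i$ and $i+1$ are in the same column of $T$; $\pi_i\cdot T=s_i\cdot T$ if $i$ is strictly right of $i+1$ in $T$, where $s_i\cdot T$ is obtained from $T$ by swapping $i$ and $i+1$. (Its image under $\mathrm{ch}$ is the extended Schur function.) Distinguished filtration. Let $\mathcal B=\{\mathcal B_\beta\mid\beta\in I\}$ be a linearly independent subset of $\mathrm{QSym}_n$ with each $\mathcal B_\beta$ expanding with nonnegative coefficients in $\{F_\gamma\}$. A distinguished filtration of an $H_n(0)$-module $M$ with respect to $\mathcal B$ is a chain of $H_n(0)$-submodules $0=M_0\subsetneq M_1\subsetneq\cdots\subsetneq M_l=M$ such that for each $1\le k\le l$, $\mathrm{ch}([M_k/M_{k-1}])=\mathcal B_\beta$ for some $\beta\in I$. *)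

(* Defs.v *)
From HB Require Import structures.
From mathcomp Require Import all_boot all_order all_algebra.
From mathcomp Require Import perm finmap multiset.
From mathcomp Require Import boolp reals complex.
From mathcomp Require Import zify.

Set Implicit Arguments.
Unset Strict Implicit.
Unset Printing Implicit Defensive.

Import Order.TTheory GRing.Theory Num.Theory.

(* Throughout, i : 'I_n.-1 stands for the integer i.+1 of
   [n-1] = {1, ..., n-1}: a subset of [n-1] is a {set 'I_n.-1}, and i indexes
   the generator pi_{i+1} of H_n(0).  Likewise k : 'I_n stands for the tableau
   entry k.+1. *)

Definition is_comp (n : nat) (a : seq nat) :=
  all (leq 1) a && (sumn a == n).

Record intcomp (n : nat) :=
  IntComp { intcomp_val :> seq nat; intcompP : is_comp n intcomp_val }.

Lemma intcomp_inj n (a b : intcomp n) : a = b :> seq nat -> a = b.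
Proof.
by case: a b => [a pa] [b pb] /= eab; subst b; rewrite (bool_irrelevance pa pb).
Qed.

(* a_1 + ... + a_k for 1 <= k <= l-1, i.e. without the last partial sum *)
Definition partial_sums (a : seq nat) : seq nat :=
  take (size a).-1 (scanl addn 0 a).

Definition cset n (a : intcomp n) : {set 'I_n.-1} :=
  [set i : 'I_n.-1 | i.+1 \in partial_sums a].

Definition subset_seq n (D : {set 'I_n.-1}) : seq nat :=
  [seq m <- iota 1 n.-1 | m \in [seq i.+1 | i : 'I_n.-1 in D]].

Definition comp_seq n (D : {set 'I_n.-1}) : seq nat :=
  if n is 0 then [::]
  else pairmap (fun x y => y - x) 0 (rcons (subset_seq D) n).

Lemma mem_subset_seq n (D : {set 'I_n.-1}) (i : 'I_n.-1) :
  (i.+1 \in subset_seq D) = (i \in D).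
Proof.
rewrite mem_filter mem_iota andbC /= add1n ltnS ltn_ord /=.
by rewrite (mem_map (f := fun i : 'I_n.-1 => i.+1)) ?mem_enum // => x y [/val_inj].
Qed.

Lemma subset_seq_path n (D : {set 'I_n.-1}) : 0 < n ->
  path ltn 0 (rcons (subset_seq D) n).
Proof.
move=> n0.
have -> : rcons (subset_seq D) n
  = [seq m <- iota 1 n | (m == n) || (m \in [seq i.+1 | i : 'I_n.-1 in D])].
  have -> : iota 1 n = rcons (iota 1 n.-1) n.
    by rewrite -{1}(prednK n0) -(addn1 n.-1) iotaD -cats1 /= add1n prednK.
  rewrite filter_rcons eqxx /=; congr rcons; apply: eq_in_filter => m.
  by rewrite mem_iota; case: eqP => //; lia.
rewrite path_min_sorted.
  by apply: sorted_filter; [exact: ltn_trans | exact: iota_ltn_sorted].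
by apply/allP => m; rewrite mem_filter mem_iota /= => /andP[_ /andP[]].
Qed.

Lemma pairmap_sub_comp x s : path ltn x s ->
  all (leq 1) (pairmap (fun x y => y - x) x s) /\
  x + sumn (pairmap (fun x y => y - x) x s) = last x s.
Proof.
elim: s x => [|y s IH] x /=; first by rewrite addn0.
move=> /andP[xy /IH[-> eqs]]; rewrite subn_gt0 xy; split=> //.
by rewrite -eqs; lia.
Qed.

Lemma comp_seqP n (D : {set 'I_n.-1}) : is_comp n (comp_seq D).
Proof.
case: n D => [|n] D //.
have [al su] := pairmap_sub_comp (subset_seq_path D isT).
by rewrite /is_comp /comp_seq al -[sumn _]add0n su last_rcons eqxx.
Qed.

Definition comp n (D : {set 'I_n.-1}) : intcomp n := IntComp (comp_seqP D).

Lemma scanl_pairmap_sub x s : path ltn x s ->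
  scanl addn x (pairmap (fun x y => y - x) x s) = s.
Proof.
elim: s x => //= y s IH x /andP[xy p].
by rewrite subnKC 1?ltnW // IH.
Qed.

Lemma compK n : cancel (@comp n) (@cset n).
Proof.
case: n => [|n] D; first by apply/setP => -[].
apply/setP => i; rewrite inE /comp /= /partial_sums size_pairmap size_rcons /=.
rewrite scanl_pairmap_sub ?subset_seq_path //.
rewrite -cats1 take_size_cat //. exact: (mem_subset_seq D).
Qed.

Lemma path_scanl_comp x a : all (leq 1) a -> path ltn x (scanl addn x a).
Proof. by elim: a x => //= y a IH x /andP[y0 /IH->]; rewrite andbT; lia. Qed.

Lemma last_scanl_comp x a : last x (scanl addn x a) = x + sumn a.
Proof. by elim: a x => /= [|y a IH] x; rewrite ?addn0 // IH addnA. Qed.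

Lemma csetK n : cancel (@cset n) (@comp n).
Proof.
case: n => [|n] [a pa]; apply: intcomp_inj => /=; case/andP: (pa).
  by case: a {pa} => //= -[|y] a //= /andP[].
move=> pos /eqP suma.
have a0 : 0 < size a by case: (a) suma.
have pth := path_scanl_comp 0 pos.
have scE : rcons (partial_sums a) n.+1 = scanl addn 0 a.
  have := last_scanl_comp 0 a; rewrite /partial_sums suma add0n.
  have := size_scanl addn 0 a; case/lastP: (scanl _ _ _) => [|s y].
    by move=> sz; move: a0; rewrite -sz.
  rewrite size_rcons last_rcons => <- ->.
  by rewrite -!cats1 take_size_cat.
have -> : subset_seq (cset (IntComp pa)) = partial_sums a.
  apply: (irr_sorted_eq ltn_trans ltnn).
  - by apply: sorted_filter; [exact: ltn_trans | exact: iota_ltn_sorted].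
  - have /path_sorted := pth; rewrite -scE -cats1; exact: (subseq_sorted ltn_trans (prefix_subseq _ _)).
  move=> m.
  have bd m' : m' \in partial_sums a -> 0 < m' < n.+1.
    move=> mm; have := pth; rewrite -scE (path_sortedE ltn_trans) all_rcons.
    rewrite (sorted_pairwise ltn_trans) pairwise_rcons.
    by move=> /andP[/andP[_ /allP/(_ _ mm) ->] /andP[/allP/(_ _ mm)]].
  apply/idP/idP => [|mm].
    rewrite mem_filter => /andP[/imageP[i ip ->] _].
    by rewrite inE in ip.
  have := bd _ mm; case: m mm => // m mm /= mn.
  by rewrite (mem_subset_seq _ (Ordinal (mn : m < n.+1.-1))) inE.
by rewrite scE scanlK // => x y /=; rewrite addKn.
Qed.

(* s is a shuffle of t and u: the positions marked by the mask m carry t, the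
   others carry u. *)
Definition is_shuffle (t u s : seq nat) : Prop :=
  exists m : bitseq,
    [/\ size m = size s, mask m s = t & mask (map negb m) s = u].

Definition is_part (l : seq nat) := sorted geq l && all (leq 1) l.

(* (i, j), 0-based: i.+1 is the row from the bottom, j.+1 the column *)
Definition cell (a : seq nat) : finType := {i : 'I_(size a) & 'I_(nth 0 a i)}.

Definition crow a (c : cell a) : nat := tag c.
Definition ccol a (c : cell a) : nat := tagged c.

Definition filling n (a : seq nat) : finType := {ffun cell a -> 'I_n}.

Section Tableaux.
Variables (n : nat) (a : intcomp n).
Implicit Type T : filling n a.

Definition is_standard T := [forall k, #|[set c | T c == k]| == 1].

Definition rows_increasing T :=
  [forall c, forall d, (crow c == crow d) && (ccol c < ccol d) ==> (T c < T d)].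

Definition columns_increasing T :=
  [forall c, forall d, (ccol c == ccol d) && (crow c < crow d) ==> (T c < T d)].

Definition first_column_increasing T :=
  [forall c, forall d,
     [&& ccol c == 0, ccol d == 0 & crow c < crow d] ==> (T c < T d)].

(* c = (i, k+1), d = (j, k), e = (j, k+1) *)
Definition young_triple T :=
  [forall c, forall d,
     [&& ccol c == (ccol d).+1, crow c < crow d & T d <= T c] ==>
     [exists e, [&& crow e == crow d, ccol e == ccol c & T e < T c]]].

Definition is_SYCT T :=
  [&& is_standard T, rows_increasing T, first_column_increasing T
    & young_triple T].

Definition is_SET T :=
  [&& is_standard T, rows_increasing T & columns_increasing T].

(* The column of the entry k; the default value is never taken when T is
   standard. *)
Definition entry_col T (k : 'I_n) : nat :=
  if [pick c | T c == k] is Some c then ccol c else 0.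

End Tableaux.

Lemma ltn_ord_pred n (i : 'I_n.-1) : i.+1 < n.
Proof. by case: n i => [|n] i; have := ltn_ord i. Qed.

(* The entries i.+1 and i.+2, for i : 'I_n.-1 standing for i.+1 *)
Definition entry_lo n (i : 'I_n.-1) : 'I_n := Ordinal (ltnW (ltn_ord_pred i)).
Definition entry_hi n (i : 'I_n.-1) : 'I_n := Ordinal (ltn_ord_pred i).

Definition Des n (a : intcomp n) (T : filling n a) : {set 'I_n.-1} :=
  [set i | entry_col T (entry_hi i) <= entry_col T (entry_lo i)].

Record SET n (a : intcomp n) := MkSET { SET_val :> filling n a; _ : is_SET SET_val }.

HB.instance Definition _ n (a : intcomp n) := [isSub for @SET_val n a].
HB.instance Definition _ n (a : intcomp n) := [Finite of SET a by <:].

Definition swap_entries n (a : intcomp n) (i : 'I_n.-1) (T : filling n a) :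
    filling n a :=
  [ffun c => tperm (entry_lo i) (entry_hi i) (T c)].

(* pi_i . T, where None stands for 0 *)
Definition filling_pi n (a : intcomp n) (i : 'I_n.-1) (T : filling n a) :
    option (filling n a) :=
  if entry_col T (entry_lo i) < entry_col T (entry_hi i) then Some T
  else if entry_col T (entry_lo i) == entry_col T (entry_hi i) then None
  else Some (swap_entries i T).

Section SETaction.
Variables (n : nat) (a : intcomp n).
Implicit Types (i j : 'I_n.-1) (T : filling n a).

Lemma entry_col_swap i T k :
  entry_col (swap_entries i T) k =
  entry_col T (tperm (entry_lo i) (entry_hi i) k).
Proof.
rewrite /entry_col; congr (if _ is Some c then _ else _).
by apply: eq_pick => c; rewrite /= ffunE (canF_eq (tpermK _ _)).
Qed.

Lemma swap_entriesK i : involutive (@swap_entries n a i).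
Proof. by move=> T; apply/ffunP => c; rewrite !ffunE tpermK. Qed.

Lemma filling_pi_idem i T :
  obind (filling_pi i) (filling_pi i T) = filling_pi i T.
Proof.
rewrite {2 3}/filling_pi; case: ltngtP => //= h; first by rewrite /filling_pi h.
by rewrite /filling_pi !entry_col_swap tpermL tpermR h.
Qed.

Lemma filling_pi_comm i j T : i.+1 < j ->
  obind (filling_pi i) (filling_pi j T) = obind (filling_pi j) (filling_pi i T).
Proof.
move=> ij.
have [n1 n2 n3 n4] : [/\ entry_lo i != entry_lo j, entry_lo i != entry_hi j,
    entry_hi i != entry_lo j & entry_hi i != entry_hi j].
  by split; rewrite -val_eqE /=; lia.
have swC : swap_entries i (swap_entries j T) = swap_entries j (swap_entries i T).
  apply/ffunP => c; rewrite !ffunE -!permM; congr (fun_of_perm _ _).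
  by rewrite conjgC tpermJ !tpermD // eq_sym.
have d1 : tperm (entry_lo i) (entry_hi i) (entry_lo j) = entry_lo j.
  by rewrite tpermD.
have d2 : tperm (entry_lo i) (entry_hi i) (entry_hi j) = entry_hi j.
  by rewrite tpermD.
have d3 : tperm (entry_lo j) (entry_hi j) (entry_lo i) = entry_lo i.
  by rewrite tpermD // eq_sym.
have d4 : tperm (entry_lo j) (entry_hi j) (entry_hi i) = entry_hi i.
  by rewrite tpermD // eq_sym.
have colE := (entry_col_swap, d1, d2, d3, d4).
case h1: (entry_col T (entry_lo i) < entry_col T (entry_hi i));
case h2: (entry_col T (entry_lo i) == entry_col T (entry_hi i));
case h3: (entry_col T (entry_lo j) < entry_col T (entry_hi j));
case h4: (entry_col T (entry_lo j) == entry_col T (entry_hi j));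
by rewrite /filling_pi ?(h1, h2, h3, h4) /= ?colE ?(h1, h2, h3, h4) ?swC.
Qed.

Lemma filling_pi_braid i j T : val j = i.+1 ->
  obind (filling_pi i) (obind (filling_pi j) (filling_pi i T)) =
  obind (filling_pi j) (obind (filling_pi i) (filling_pi j T)).
Proof.
move=> /= ij; have yE : entry_hi i = entry_lo j by apply: val_inj; rewrite /= ij.
have xy : entry_lo i != entry_lo j by rewrite -val_eqE /=; lia.
have xz : entry_lo i != entry_hi j by rewrite -val_eqE /=; lia.
have yz : entry_lo j != entry_hi j by rewrite -val_eqE /=; lia.
have tB : (tperm (entry_lo i) (entry_lo j) * tperm (entry_lo j) (entry_hi j) *
      tperm (entry_lo i) (entry_lo j))%g =
    (tperm (entry_lo j) (entry_hi j) * tperm (entry_lo i) (entry_lo j) *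
      tperm (entry_lo j) (entry_hi j))%g.
  rewrite -{1}(tpermV (entry_lo i)) -{2}(tpermV (entry_lo j)) -!mulgA -!conjgE.
  by rewrite !tpermJ tpermR tpermL !tpermD // eq_sym.
have swB : swap_entries i (swap_entries j (swap_entries i T)) =
    swap_entries j (swap_entries i (swap_entries j T)).
  apply/ffunP => c; rewrite !ffunE -!permM yE; congr (fun_of_perm _ _).
  by rewrite !mulgA tB.
have ci T' k : entry_col (swap_entries i T') k =
    entry_col T' (tperm (entry_lo i) (entry_lo j) k) by rewrite entry_col_swap yE.
have cj T' k : entry_col (swap_entries j T') k =
    entry_col T' (tperm (entry_lo j) (entry_hi j) k) by rewrite entry_col_swap.
have pz : tperm (entry_lo i) (entry_lo j) (entry_hi j) = entry_hi j by rewrite tpermD.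
have px : tperm (entry_lo j) (entry_hi j) (entry_lo i) = entry_lo i.
  by rewrite tpermD // eq_sym.
have fi T' : filling_pi i T' =
  if entry_col T' (entry_lo i) < entry_col T' (entry_lo j) then Some T'
  else if entry_col T' (entry_lo i) == entry_col T' (entry_lo j) then None
  else Some (swap_entries i T') by rewrite -yE.
have fj T' : filling_pi j T' =
  if entry_col T' (entry_lo j) < entry_col T' (entry_hi j) then Some T'
  else if entry_col T' (entry_lo j) == entry_col T' (entry_hi j) then None
  else Some (swap_entries j T') by [].
have colE := (ci, cj, tpermL, tpermR, pz, px).
have k1 : (entry_col T (entry_lo j) < entry_col T (entry_lo i)) =
  ~~ (entry_col T (entry_lo i) < entry_col T (entry_lo j)) &&
  ~~ (entry_col T (entry_lo i) == entry_col T (entry_lo j)) by lia.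
have k2 : (entry_col T (entry_hi j) < entry_col T (entry_lo j)) =
  ~~ (entry_col T (entry_lo j) < entry_col T (entry_hi j)) &&
  ~~ (entry_col T (entry_lo j) == entry_col T (entry_hi j)) by lia.
have k3 : (entry_col T (entry_hi j) < entry_col T (entry_lo i)) =
  ~~ (entry_col T (entry_lo i) < entry_col T (entry_hi j)) &&
  ~~ (entry_col T (entry_lo i) == entry_col T (entry_hi j)) by lia.
case h1: (entry_col T (entry_lo i) < entry_col T (entry_lo j));
case h2: (entry_col T (entry_lo j) < entry_col T (entry_hi j));
case h3: (entry_col T (entry_lo i) < entry_col T (entry_hi j));
case h4: (entry_col T (entry_lo i) == entry_col T (entry_lo j));
case h5: (entry_col T (entry_lo j) == entry_col T (entry_hi j));
case h6: (entry_col T (entry_lo i) == entry_col T (entry_hi j));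
try lia;
by do 3?rewrite ?fi ?fj /= ?(k1, k2, k3, h1, h2, h3, h4, h5, h6, colE) /= ?swB.
Qed.

End SETaction.

Section SETmodule.
Variables (n : nat) (a : intcomp n).
Implicit Types (i j : 'I_n.-1) (T : filling n a).

Lemma entry_colE T k c : is_standard T -> T c = k -> entry_col T k = ccol c.
Proof.
move=> /forallP/(_ k)/cards1P[c0 cE] Tc; rewrite /entry_col.
have e d : T d = k -> d = c0 by move=> Td; apply/set1P; rewrite -cE inE Td.
case: pickP => [d /eqP /e -> | /(_ c)]; last by rewrite /= Tc eqxx.
by rewrite (e _ Tc).
Qed.

Lemma swap_entries_ltn i T c d : T c < T d ->
  ~~ ((T c == entry_lo i) && (T d == entry_hi i)) ->
  swap_entries i T c < swap_entries i T d.
Proof.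
rewrite !ffunE !permE /= -!val_eqE /= => cd.
by do !case: eqP => /= ?; lia.
Qed.

Lemma is_SET_swap i T :
  is_SET T -> entry_col T (entry_hi i) < entry_col T (entry_lo i) ->
  is_SET (swap_entries i T).
Proof.
move=> /and3P[st /forallP rows /forallP cols] lt.
have nc c d : ccol c <= ccol d -> ~~ ((T c == entry_lo i) && (T d == entry_hi i)).
  move=> cd; apply/negP => /andP[/eqP /(entry_colE st) ec /eqP /(entry_colE st) ed].
  by move: lt; rewrite ec ed ltnNge cd.
apply/and3P; split.
- apply/forallP => k; move/forallP: st => /(_ (tperm (entry_lo i) (entry_hi i) k)).
  congr (#|pred_of_set _| == 1); apply/setP => c; rewrite !inE ffunE.
  by rewrite (canF_eq (tpermK _ _)).
- apply/forallP => c; apply/forallP => d; apply/implyP => /andP[rcd ccd].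
  apply: swap_entries_ltn; last exact/nc/ltnW.
  by have /forallP/(_ d)/implyP := rows c; apply; rewrite rcd.
- apply/forallP => c; apply/forallP => d; apply/implyP => /andP[/eqP ccd rcd].
  apply: swap_entries_ltn; last by apply: nc; rewrite ccd.
  by have /forallP/(_ d)/implyP := cols c; apply; rewrite ccd eqxx.
Qed.

(* insub never fails here, by filling_pi_SET. *)
Definition SET_pi i (T : SET a) : option (SET a) :=
  obind insub (filling_pi i (val T)).

Lemma filling_pi_SET i (T : SET a) : omap val (SET_pi i T) = filling_pi i (val T).
Proof.
rewrite /SET_pi /filling_pi; case: ltngtP => //= h; first by rewrite valK.
by rewrite insubT //; apply: is_SET_swap => //; exact: valP.
Qed.

Lemma omap_SET_pi i (T : option (SET a)) :
  omap val (obind (SET_pi i) T) = obind (filling_pi i) (omap val T).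
Proof. by case: T => //= T; exact: filling_pi_SET. Qed.

Lemma SET_pi_idem i (T : SET a) : obind (SET_pi i) (SET_pi i T) = SET_pi i T.
Proof.
apply: (inj_omap val_inj).
by rewrite omap_SET_pi !filling_pi_SET filling_pi_idem.
Qed.

Lemma SET_pi_braid i j (T : SET a) : val j = i.+1 ->
  obind (SET_pi i) (obind (SET_pi j) (SET_pi i T)) =
  obind (SET_pi j) (obind (SET_pi i) (SET_pi j T)).
Proof.
move=> ij; apply: (inj_omap val_inj).
by rewrite !omap_SET_pi !filling_pi_SET filling_pi_braid.
Qed.

Lemma SET_pi_comm i j (T : SET a) : i.+1 < j ->
  obind (SET_pi i) (SET_pi j T) = obind (SET_pi j) (SET_pi i T).
Proof.
move=> ij; apply: (inj_omap val_inj).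
by rewrite !omap_SET_pi !filling_pi_SET filling_pi_comm.
Qed.

End SETmodule.

Local Open Scope ring_scope.

Section HeckeModules.
Variable R : realType.
Local Notation C := (complex R).

(* Formal power series in x_0 < x_1 < x_2 < ...; a monomial is the multiset of
   the indices of its variables. *)
Definition fps := {mset nat}%mset -> C.

(* Distinct words i_1 <= ... <= i_n have distinct monomials, so every
   coefficient of F_a is 0 or 1.  Here i_j is nth 0 w j.-1. *)
Definition fundamental n (a : intcomp n) : fps := fun m =>
  (`[< exists w : seq nat,
       [/\ size w = n, sorted leq w,
           forall j : 'I_n.-1, j \in cset a -> (nth 0 w j < nth 0 w j.+1)%N
         & m = seq_mset w] >] : bool)%:R.

Definition young_qschur n (b : intcomp n) : fps := fun m =>
  \sum_(T : filling n b | is_SYCT T) fundamental (comp (Des T)) m.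

(* As H_n(0) is presented by generators and relations, a module over it is a
   vector space with operators pi_i satisfying these relations; as H_n(0) is
   finite-dimensional, finitely generated means finite-dimensional. *)
Record hmodule (n : nat) := HModule {
  hm_space :> vectType C;
  hm_pi : 'I_n.-1 -> 'End(hm_space);
  hm_idem : forall i v, hm_pi i (hm_pi i v) = hm_pi i v;
  hm_braid : forall (i j : 'I_n.-1) v, val j = i.+1 ->
    hm_pi i (hm_pi j (hm_pi i v)) = hm_pi j (hm_pi i (hm_pi j v));
  hm_comm : forall (i j : 'I_n.-1) v, (i.+1 < j)%N ->
    hm_pi i (hm_pi j v) = hm_pi j (hm_pi i v) }.

Definition hm_hom n (M N : hmodule n) (f : 'Hom(M, N)) : Prop :=
  forall i v, f (hm_pi M i v) = hm_pi N i (f v).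

Definition short_exact n (M' M M'' : hmodule n) : Prop :=
  exists (f : 'Hom(M', M)) (g : 'Hom(M, M'')),
    [/\ hm_hom f, hm_hom g, lker f = 0%VS, limg f = lker g & limg g = fullv].

Section SimpleModule.
Variables (n : nat) (a : intcomp n).

Definition simple_pi (i : 'I_n.-1) : 'End(C^o) :=
  if i \in cset a then 0 else \1%VF.

Lemma simple_pi_idem i v : simple_pi i (simple_pi i v) = simple_pi i v.
Proof. by rewrite /simple_pi; case: ifP => _; rewrite ?lfunE. Qed.

Lemma simple_pi_comm i j v :
  simple_pi i (simple_pi j v) = simple_pi j (simple_pi i v).
Proof.
by rewrite /simple_pi; do 2!case: ifP => _; rewrite !(zero_lfunE, id_lfunE).
Qed.

Lemma simple_pi_braid (i j : 'I_n.-1) v : val j = i.+1 ->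
  simple_pi i (simple_pi j (simple_pi i v)) =
  simple_pi j (simple_pi i (simple_pi j v)).
Proof.
by rewrite /simple_pi => _; do 2!case: ifP => _; rewrite !(zero_lfunE, id_lfunE).
Qed.

Definition simple_module : hmodule n :=
  HModule simple_pi_idem simple_pi_braid (fun i j v _ => simple_pi_comm i j v).

End SimpleModule.

(* ch_eq M f means ch([M]) = f: ch is determined by its values on the simple
   modules and additivity on short exact sequences; f is unique by
   ch_eq_unique. *)
Inductive ch_eq n : hmodule n -> fps -> Prop :=
| ch_eq_zero (M : hmodule n) : \dim {: M} = 0%N -> ch_eq M (fun=> 0)
| ch_eq_simple (a : intcomp n) : ch_eq (simple_module a) (fundamental a)
| ch_eq_exact (M' M M'' : hmodule n) (f g : fps) :
    short_exact M' M M'' -> ch_eq M' f -> ch_eq M'' g ->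
    ch_eq M (fun m => f m + g m).

(* ch_eq is functional: the coefficient of ch([M]) at the monomial of a word w
   is the trace on M of the product of the pi_j over the non-ascents j of w,
   and traces are additive on short exact sequences. *)
Section Uniqueness.
Import VectorInternalTheory.

Definition lftr (V : vectType C) (f : 'End(V)) : C := \tr (f2mx f).

Lemma f2mx_comp (U V W : vectType C) (f : 'Hom(V, W)) (g : 'Hom(U, V)) :
  f2mx (f \o g)%VF = f2mx g *m f2mx f.
Proof.
suff -> : (f \o g)%VF = Hom (f2mx g *m f2mx f) by [].
by apply/lfunP => v; rewrite comp_lfunE unlock /= r2vK mulmxA.
Qed.

Lemma lftrC (V W : vectType C) (f : 'Hom(V, W)) (g : 'Hom(W, V)) :
  lftr (f \o g)%VF = lftr (g \o f)%VF.
Proof. by rewrite /lftr !f2mx_comp mxtrace_mulC. Qed.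

Lemma lftrD (V : vectType C) (f g : 'End(V)) : lftr (f + g) = lftr f + lftr g.
Proof.
rewrite /lftr -mxtraceD; congr (\tr _).
suff -> : f + g = Hom (f2mx f + f2mx g) by [].
by apply/lfunP => v; rewrite add_lfunE unlock /= mulmxDr linearD.
Qed.

Definition hm_prod n (M : hmodule n) (s : seq 'I_n.-1) : 'End(M) :=
  foldr (fun i f => (hm_pi M i \o f)%VF) \1%VF s.

Lemma hm_prod_hom n (M N : hmodule n) (f : 'Hom(M, N)) s : hm_hom f ->
  (f \o hm_prod M s)%VF = (hm_prod N s \o f)%VF.
Proof.
move=> hf; elim: s => [|i s IH] /=; first by rewrite comp_lfun1l comp_lfun1r.
rewrite -comp_lfunA -IH !comp_lfunA; congr (_ \o _)%VF.
by apply/lfunP => v; rewrite !comp_lfunE hf.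
Qed.

Lemma lftr_exact n (M' M M'' : hmodule n) s : short_exact M' M M'' ->
  lftr (hm_prod M s) = lftr (hm_prod M' s) + lftr (hm_prod M'' s).
Proof.
move=> [f] [g] [hf hg kf /vspaceP ex ig].
have gS : (g \o g^-1 = \1)%VF.
  by apply/lfunP => v; rewrite comp_lfunE id_lfunE limg_lfunVK // ig memvf.
have gf : (g \o f = 0)%VF.
  apply/lfunP => v; rewrite comp_lfunE zero_lfunE; apply/eqP.
  by rewrite -memv_ker -ex memv_img ?memvf.
have ff : (f^-1 \o f = \1)%VF by rewrite lker0_compVf // kf.
pose p := \1%VF - (g^-1 \o g)%VF : 'End(M).
have fp : (f \o (f^-1 \o p) = p)%VF.
  apply/lfunP => v; rewrite 2!comp_lfunE limg_lfunVK // ex memv_ker.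
  have -> : g (p v) = (g \o p)%VF v by rewrite comp_lfunE.
  rewrite /p comp_lfunDr comp_lfunNr comp_lfunA gS comp_lfun1l comp_lfun1r.
  by rewrite subrr zero_lfunE.
have pf : (p \o f)%VF = f.
  by rewrite /p comp_lfunDl comp_lfunNl -comp_lfunA gf comp_lfun0r subr0 comp_lfun1l.
have e1 : (\1%VF : 'End(M)) = (f \o (f^-1 \o p))%VF + (g^-1 \o g)%VF.
  by rewrite fp /p subrK.
have -> : hm_prod M s = (hm_prod M s \o f \o (f^-1 \o p))%VF + (hm_prod M s \o g^-1 \o g)%VF.
  by rewrite -!comp_lfunA -comp_lfunDr -e1 comp_lfun1r.
rewrite lftrD; congr (_ + _).
  by rewrite -hm_prod_hom // lftrC !comp_lfunA -(comp_lfunA _ p) pf ff comp_lfun1l.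
by rewrite lftrC comp_lfunA hm_prod_hom // -comp_lfunA gS comp_lfun1r.
Qed.

Lemma lftr0 (V : vectType C) : lftr (0 : 'End(V)) = 0.
Proof. by apply: (addrI (@lftr V 0)); rewrite -lftrD !addr0. Qed.

Lemma lftr_dim0 (V : vectType C) (f : 'End(V)) : \dim {: V} = 0%N -> lftr f = 0.
Proof.
move=> /eqP; rewrite dimv_eq0 => /eqP V0; rewrite (_ : f = 0) ?lftr0 //.
apply/lfunP => v; have := memvf v; rewrite V0 memv0 => /eqP ->.
by rewrite !linear0.
Qed.

Lemma lftr1 : lftr (\1%VF : 'End(C^o)) = 1.
Proof.
suff -> : (\1%VF : 'End(C^o)) = Hom 1%:M by rewrite /lftr mxtrace1.
by apply/lfunP => v; rewrite id_lfunE unlock /= mulmx1 v2rK.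
Qed.

Lemma lftr_simple n (a : intcomp n) s :
  lftr (hm_prod (simple_module a) s) = (all (fun i => i \notin cset a) s)%:R.
Proof.
have -> : hm_prod (simple_module a) s =
    if all (fun i => i \notin cset a) s then \1%VF else 0.
  elim: s => //= i s ->; rewrite /simple_pi.
  by case: (i \in _); rewrite /= ?comp_lfun0l // comp_lfun1l.
by case: ifP => _; rewrite ?lftr1 ?lftr0.
Qed.

Definition non_ascents n (w : seq nat) : seq 'I_n.-1 :=
  [seq j : 'I_n.-1 <- enum 'I_n.-1 | ~~ (nth 0 w j < nth 0 w j.+1)%N].

Lemma fundamental_word n (a : intcomp n) w : size w = n -> sorted leq w ->
  fundamental a (seq_mset w) = (all (fun i => i \notin cset a) (non_ascents n w))%:R.
Proof.
move=> sz srt; rewrite /fundamental; congr (nat_of_bool _)%:R.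
apply/asboolP/allP => [[w' [_ srt' asc /eq_seq_msetP pe]] j|asc].
  have ww : w = w'.
    exact: (sorted_eq leq_trans anti_leq srt srt' pe).
  by rewrite mem_filter ww => /andP[+ _]; apply: contra; exact: asc.
exists w; split=> // j ja; apply: contraLR ja => nlt; apply: asc.
by rewrite mem_filter nlt mem_enum.
Qed.

Lemma ch_eq_trace n (M : hmodule n) f : ch_eq M f ->
  (forall w, size w = n -> sorted leq w ->
    f (seq_mset w) = lftr (hm_prod M (non_ascents n w))) /\
  (forall m, ~ (exists w, [/\ size w = n, sorted leq w & m = seq_mset w]) ->
    f m = 0).
Proof.
elim=> {M f} [M dM|a|M' M M'' f g ex _ [fw f0] _ [gw g0]]; split=> //.
- by move=> w _ _; rewrite lftr_dim0.
- by move=> w sz srt; rewrite lftr_simple fundamental_word.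
- move=> m mw; rewrite /fundamental; case: asboolP => // -[w [sz srt _ mw']].
  by exfalso; apply: mw; exists w.
- by move=> w sz srt; rewrite (lftr_exact _ ex) fw ?gw.
- by move=> m mw; rewrite f0 ?g0 ?addr0.
Qed.

Lemma ch_eq_unique n (M : hmodule n) (f g : fps) : ch_eq M f -> ch_eq M g -> f = g.
Proof.
move=> /ch_eq_trace[fw f0] /ch_eq_trace[gw g0]; apply: funext => m.
have [[w [sz srt ->]]|nw] :=
  pselect (exists w, [/\ size w = n, sorted leq w & m = seq_mset w]).
  by rewrite fw ?gw.
by rewrite f0 ?g0.
Qed.

End Uniqueness.

Record submodule n (M : hmodule n) := Submodule {
  sm_space :> {vspace M};
  sm_stable : forall i v, v \in sm_space -> hm_pi M i v \in sm_space }.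

Section Sub.
Variables (n : nat) (M : hmodule n) (U : submodule M).

Definition sub_pi (i : 'I_n.-1) : 'End(subvs_of U) :=
  linfun (vsproj U \o hm_pi M i \o vsval).

Lemma sub_piE i v : vsval (sub_pi i v) = hm_pi M i (vsval v).
Proof. by rewrite lfunE /= vsprojK // sm_stable // subvsP. Qed.

Lemma sub_pi_idem i v : sub_pi i (sub_pi i v) = sub_pi i v.
Proof. by apply: val_inj; rewrite /= !sub_piE hm_idem. Qed.

Lemma sub_pi_braid (i j : 'I_n.-1) v : val j = i.+1 ->
  sub_pi i (sub_pi j (sub_pi i v)) = sub_pi j (sub_pi i (sub_pi j v)).
Proof. by move=> ij; apply: val_inj; rewrite /= !sub_piE hm_braid. Qed.

Lemma sub_pi_comm (i j : 'I_n.-1) v : (i.+1 < j)%N ->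
  sub_pi i (sub_pi j v) = sub_pi j (sub_pi i v).
Proof. by move=> ij; apply: val_inj; rewrite /= !sub_piE hm_comm. Qed.

Definition sub_module : hmodule n := HModule sub_pi_idem sub_pi_braid sub_pi_comm.

End Sub.

Section Quotient.
Variables (n : nat) (M : hmodule n) (W : submodule M).

(* The complement W^C represents M / W; quot_map is the projection onto it
   along W. *)
Definition quot_map : 'Hom(M, subvs_of (W^C)%VS) :=
  linfun (vsproj (W^C)%VS \o daddv_pi (W^C)%VS W).

Lemma vsval_quot_map v : vsval (quot_map v) = daddv_pi (W^C)%VS W v.
Proof. by rewrite lfunE /= vsprojK // memv_pi. Qed.

Lemma capv_complC : (W^C :&: W)%VS = 0%VS.
Proof. by rewrite capvC capv_compl. Qed.

Lemma quot_map_vsval x : quot_map (vsval x) = x.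
Proof.
apply: val_inj; rewrite /= vsval_quot_map daddv_pi_id ?capv_complC //.
exact: subvsP.
Qed.

Lemma quot_map_decomp v : v - vsval (quot_map v) \in (W : {vspace M}).
Proof.
rewrite vsval_quot_map.
have {1}<- : daddv_pi (W^C)%VS W v + daddv_pi W (W^C)%VS v = v.
  by rewrite daddv_pi_add ?capv_complC // addvC addv_complf memvf.
by rewrite addrC addKr memv_pi.
Qed.

Lemma quot_map_eq0 v : (quot_map v == 0) = (v \in (W : {vspace M})).
Proof.
apply/eqP/idP => [qv|vW].
  by have := quot_map_decomp v; rewrite qv subr0.
apply: val_inj; rewrite /= vsval_quot_map; apply/eqP; rewrite -memv0 -capv_complC.
rewrite memv_cap memv_pi /= -[X in X \in _](subrK v) memvD //.
by rewrite -opprB memvN -vsval_quot_map quot_map_decomp.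
Qed.

Lemma lker_quot_map : lker quot_map = W.
Proof. by apply/vspaceP => v; rewrite memv_ker quot_map_eq0. Qed.

Lemma limg_quot_map : limg quot_map = fullv.
Proof.
apply/vspaceP => x; rewrite memvf -(quot_map_vsval x) memv_img //; exact: memvf.
Qed.

Definition quot_pi (i : 'I_n.-1) : 'End(subvs_of (W^C)%VS) :=
  linfun (quot_map \o hm_pi M i \o vsval).

Lemma quot_map_hom i v : quot_map (hm_pi M i v) = quot_pi i (quot_map v).
Proof.
rewrite [RHS]lfunE /=; apply/eqP; rewrite -subr_eq0 -!linearB quot_map_eq0.
exact/sm_stable/quot_map_decomp.
Qed.

Lemma quot_pi_idem i x : quot_pi i (quot_pi i x) = quot_pi i x.
Proof. by rewrite -(quot_map_vsval x) -!quot_map_hom hm_idem. Qed.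

Lemma quot_pi_braid (i j : 'I_n.-1) x : val j = i.+1 ->
  quot_pi i (quot_pi j (quot_pi i x)) = quot_pi j (quot_pi i (quot_pi j x)).
Proof. by move=> ij; rewrite -(quot_map_vsval x) -!quot_map_hom hm_braid. Qed.

Lemma quot_pi_comm (i j : 'I_n.-1) x : (i.+1 < j)%N ->
  quot_pi i (quot_pi j x) = quot_pi j (quot_pi i x).
Proof. by move=> ij; rewrite -(quot_map_vsval x) -!quot_map_hom hm_comm. Qed.

Definition quot_module : hmodule n :=
  HModule quot_pi_idem quot_pi_braid quot_pi_comm.

End Quotient.

Section Factor.
Variables (n : nat) (M : hmodule n) (U W : submodule M).

Definition restrict_space : {vspace sub_module U} :=
  ((linfun vsval : 'Hom(sub_module U, M)) @^-1: W)%VS.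

Lemma mem_restrict_space (u : sub_module U) :
  (u \in restrict_space) = (vsval u \in (W : {vspace M})).
Proof. by rewrite -memv_preim lfunE. Qed.

Lemma restrict_stable i (u : sub_module U) :
  u \in restrict_space -> hm_pi (sub_module U) i u \in restrict_space.
Proof. by rewrite !mem_restrict_space /= sub_piE; exact: sm_stable. Qed.

Definition factor_module : hmodule n := quot_module (Submodule restrict_stable).

End Factor.

Section XModule.
Variables (n : nat) (a : intcomp n).

Definition SET_basis (T : option (SET a)) : {ffun SET a -> C^o} :=
  [ffun S => (T == Some S)%:R].

Definition X_pi_fun (i : 'I_n.-1) (v : {ffun SET a -> C^o}) :
    {ffun SET a -> C^o} :=
  \sum_(T : SET a) v T *: SET_basis (SET_pi i T).

Fact X_pi_fun_linear i : linear (X_pi_fun i).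
Proof.
move=> c u v; rewrite /X_pi_fun scaler_sumr -big_split; apply: eq_bigr => T _ /=.
by rewrite !ffunE scalerDl scalerA.
Qed.

HB.instance Definition _ i :=
  GRing.isLinear.Build C {ffun SET a -> C^o} {ffun SET a -> C^o} _
    (X_pi_fun i) (X_pi_fun_linear i).

Definition X_pi (i : 'I_n.-1) : 'End({ffun SET a -> C^o}) := linfun (X_pi_fun i).

Lemma SET_basisE (v : {ffun SET a -> C^o}) :
  v = \sum_(T : SET a) v T *: SET_basis (Some T).
Proof.
apply/ffunP => S; rewrite sum_ffunE (bigD1 S) //= big1 => [|T TS].
  by rewrite !ffunE eqxx addr0 [_ *: _]mulr1.
by rewrite !ffunE (inj_eq Some_inj) (negPf TS) scaler0.
Qed.

Lemma X_pi_basis i (T : option (SET a)) :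
  X_pi i (SET_basis T) = SET_basis (obind (SET_pi i) T).
Proof.
rewrite lfunE /= /X_pi_fun; case: T => [T|] /=.
  rewrite (bigD1 T) //= big1 ?addr0 => [|S ST].
    by rewrite ffunE eqxx scale1r.
  by rewrite ffunE (inj_eq Some_inj) eq_sym (negPf ST) scale0r.
rewrite big1 => [|S _]; last by rewrite ffunE scale0r.
by apply/ffunP => S; rewrite !ffunE.
Qed.

Lemma X_pi_sum i (c : SET a -> C^o) (s : SET a -> option (SET a)) :
  X_pi i (\sum_(T : SET a) c T *: SET_basis (s T)) =
  \sum_(T : SET a) c T *: SET_basis (obind (SET_pi i) (s T)).
Proof.
by rewrite linear_sum; apply: eq_bigr => T _; rewrite linearZ_LR; congr (_ *: _); exact: X_pi_basis.
Qed.

Lemma X_pi_expand v : exists b : (SET a -> option (SET a)) -> {ffun SET a -> C^o},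
  v = b Some /\ forall i s, X_pi i (b s) = b (fun T => obind (SET_pi i) (s T)).
Proof.
exists (fun s => \sum_(T : SET a) v T *: SET_basis (s T)); split.
  exact: SET_basisE.
by move=> i s; exact: X_pi_sum.
Qed.

Lemma X_pi_idem i v : X_pi i (X_pi i v) = X_pi i v.
Proof.
have [b [-> e]] := X_pi_expand v.
apply: (etrans (congr1 (X_pi i) (e i Some))); apply: (etrans (e i _)).
apply: (etrans _ (esym (e i Some))).
by congr b; apply: funext => T; exact: SET_pi_idem.
Qed.

Lemma X_pi_braid (i j : 'I_n.-1) v : val j = i.+1 ->
  X_pi i (X_pi j (X_pi i v)) = X_pi j (X_pi i (X_pi j v)).
Proof.
move=> ij; have [b [-> e]] := X_pi_expand v.
have e3 k l : X_pi k (X_pi l (X_pi k (b Some))) =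
    b (fun T => obind (SET_pi k) (obind (SET_pi l) (SET_pi k T))).
  apply: (etrans (congr1 (fun x => X_pi k (X_pi l x)) (e k Some))).
  by apply: (etrans (congr1 (X_pi k) (e l _))); apply: (etrans (e k _)).
apply: (etrans (e3 i j)); apply: (etrans _ (esym (e3 j i))).
by congr b; apply: funext => T; exact: SET_pi_braid.
Qed.

Lemma X_pi_comm (i j : 'I_n.-1) v : (i.+1 < j)%N ->
  X_pi i (X_pi j v) = X_pi j (X_pi i v).
Proof.
move=> ij; have [b [-> e]] := X_pi_expand v.
have e2 k l : X_pi k (X_pi l (b Some)) =
    b (fun T => obind (SET_pi k) (SET_pi l T)).
  by apply: (etrans (congr1 (X_pi k) (e l Some))); apply: (etrans (e k _)).
apply: (etrans (e2 i j)); apply: (etrans _ (esym (e2 j i))).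
by congr b; apply: funext => T; exact: SET_pi_comm.
Qed.

Definition X_module : hmodule n := HModule X_pi_idem X_pi_braid X_pi_comm.

End XModule.

(* B is meant to be linearly independent and F-positive; these are conditions
   on B alone, not part of what a filtration of M is. *)
Definition distinguished_filtration n (M : hmodule n) (I : Type) (B : I -> fps) :
    Prop :=
  exists (l : nat) (N : nat -> submodule M),
    [/\ N 0 = 0%VS :> {vspace M}, N l = fullv :> {vspace M}
      & forall k, (k < l)%N ->
        [/\ (N k <= N k.+1)%VS, (N k : {vspace M}) != N k.+1
          & exists b : I, ch_eq (factor_module (N k.+1) (N k)) (B b)]].

End HeckeModules.

(* Main.v *)
Require Import Defs.
From HB Require Import structures.
From mathcomp Require Import all_boot all_order all_algebra all_fingroup.
From mathcomp Require Import boolp reals complex.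
From mathcomp Require Import zify.

(* Build a filling with increasing rows by inserting 1, 2, ..., n: each entry
   extends a row, and its column is the former length of that row. The Young
   composition tableaux are the fillings in which every entry extends the
   highest row of the required length (or starts a new top row). Hence such a
   tableau is determined by its word of columns, every word of columns of a
   filling is the word of exactly one of them, and the numbers
   N(k, t) = #{rows >= t of length > k} satisfy a recursion in that word: an
   entry in column c > 0 replaces N(c, t) by min(N(c, t) + 1, N(c - 1, t)).
   For an arbitrary filling N(k, t) is bounded by the result of the recursion.

   Let sh(T) be the shape of the Young composition tableau with the columns of
   T in SET(a). The recursion is monotone, so if pi_i swaps i and i+1 in T then
   the numbers N(k, t) of sh(T) weakly increase, and they determine sh(T). So
   filtering SET(a) by the sum of the N(k, t) of the shape (and separating the
   shapes) gives submodules. When a is a shuffle, the only condition on a word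
   of columns to come from SET(a), besides its content, relates the first two
   columns, and it amounts to N(1, t) being at least the value for a; it
   depends on the shape only. Hence each factor has a basis with the
   columns, and so the descents, of SYCT(b) for a single b, on which the pi_i
   act triangularly. *)

Set Implicit Arguments.
Unset Strict Implicit.
Unset Printing Implicit Defensive.

Import GRing.Theory.

(** * Row histories *)

Section Histories.
Implicit Types (h : seq nat) (a b w : seq nat).

(* A filling with increasing rows is encoded by its history: the list of the
   rows of its entries, the last entry first. When j is put in front of h, the
   new cell is in column count_mem j h (0-based). *)
Fixpoint cols h : seq nat :=
  if h is j :: h' then count_mem j h' :: cols h' else [::].

(** Counts the cells in column [k] of the rows from [t] on. A row longer than [k] has exactly one
    such cell, so this is the number N(k, t). *)
Fixpoint long_rows h (k t : nat) : nat :=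
  if h is j :: h' then
    long_rows h' k t + ((t <= j) && (count_mem j h' == k))
  else 0.

Fixpoint all_steps (P : nat -> seq nat -> Prop) h : Prop :=
  if h is j :: h' then P j h' /\ all_steps P h' else True.

Definition first_col_step j h := j \notin h -> forall i, i < j -> i \in h.

Definition young_step j h :=
  first_col_step j h /\
  (j \in h -> forall i, j < i -> count_mem i h <> count_mem j h).

Definition column_step a j h :=
  count_mem j h < nth 0 a j /\
  forall i, i < j -> count_mem j h < nth 0 a i -> count_mem j h < count_mem i h.

Lemma all_steps_sub (P Q : nat -> seq nat -> Prop) h :
  (forall j h', P j h' -> Q j h') -> all_steps P h -> all_steps Q h.
Proof. by move=> PQ; elim: h => //= j h IH [/PQ ? /IH]. Qed.

Lemma long_rowsE h k t B : all (fun j => j < B) h ->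
  long_rows h k t = \sum_(t <= j < B) (k < count_mem j h).
Proof.
elim: h => [|j h IH] /=; first by rewrite big1.
move=> /andP[jB hB]; rewrite {}IH //.
rewrite [RHS](eq_bigr (fun i => (k < count_mem i h) + ((i == j) && (count_mem j h == k)))).
  rewrite big_split /=; congr (_ + _).
  case: leqP => tj.
    rewrite (bigD1_seq j) ?mem_index_iota ?iota_uniq ?tj //= eqxx big1 ?addn0 //.
    by move=> i /negPf ->.
  rewrite big_nat_cond big1 // => i /andP[/andP[ti iB] _].
  by case: eqP => //; lia.
move=> i _; rewrite [j == i]eq_sym; case: eqP => [->|] /=; last by rewrite addn0.
by case: ltngtP; lia.
Qed.

Lemma history_bound h : exists B, all (fun j => j < B) h.
Proof.
exists (\max_(j <- h) j).+1; apply/allP => j jh; rewrite ltnS.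
exact: (leq_bigmax_seq _ jh).
Qed.

Lemma long_rows_leq h k t : long_rows h k.+1 t <= long_rows h k t.
Proof.
have [B hB] := history_bound h; rewrite !(long_rowsE _ _ hB).
by apply: leq_sum => j _; lia.
Qed.

Lemma long_rowsP h k t :
  reflect (exists2 j, t <= j & count_mem j h = k.+1)
    (long_rows h k.+1 t < long_rows h k t).
Proof.
apply: (iffP idP); have [B hB] := history_bound h; rewrite !(long_rowsE _ _ hB).
move=> lt.
  have [/hasP[j]|/hasPn no] := boolP (has (fun j => count_mem j h == k.+1) (index_iota t B)).
    by rewrite mem_index_iota => /andP[tj _] /eqP ?; exists j.
  move: lt; rewrite big_nat_cond [X in _ < X]big_nat_cond.
  rewrite (eq_bigr (fun j => (k < count_mem j h) : nat)) ?ltnn // => j /andP[jB _].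
  by have := no j; rewrite mem_index_iota jB => /(_ isT); lia.
move=> [j tj cj]; have jB : j < B.
  by apply: (allP hB); rewrite -has_pred1 has_count; lia.
rewrite !(bigD1_seq (r := index_iota t B) j) ?mem_index_iota ?iota_uniq ?tj //=.
by rewrite cj ltnn ltnSn add0n add1n ltnS; apply: leq_sum => i _; lia.
Qed.

Lemma long_rows0 h k : long_rows h k 0 = count_mem k (cols h).
Proof. by elim: h => //= j h ->; lia. Qed.

(** The entries of [g] add at least as much to N(k, 0) as to N(k, t); the additive form avoids
    subtraction. *)
Lemma long_rows_cat h g k t :
  long_rows (g ++ h) k t + long_rows h k 0 <= long_rows h k t + long_rows (g ++ h) k 0.
Proof. by elim: g => /= [|j g IH]; lia. Qed.

Lemma size_cols h : size (cols h) = size h.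
Proof. by elim: h => //= j h ->. Qed.

(** New rows start in order, so the nonempty rows always form an initial segment. *)
Lemma first_col_mem h j : all_steps first_col_step h ->
  (j \in h) = (j < long_rows h 0 0).
Proof.
elim: h j => //= i h IH j [st hs]; have {}IH i' := IH i' hs; rewrite inE.
rewrite -[count_mem i h == 0]negbK -lt0n -has_count has_pred1 IH.
have := IH i; case: (boolP (i \in h)) => [ih|ih] /esym /= lt.
  by case: eqP => [->|]; lia.
suff -> : i = long_rows h 0 0 by lia.
by have := st ih (long_rows h 0 0); rewrite IH; lia.
Qed.

Lemma first_col_new j h : all_steps first_col_step h -> first_col_step j h ->
  j \notin h -> j = long_rows h 0 0.
Proof.
move=> hs st jh; have := st jh (long_rows h 0 0).
by move: jh; rewrite !first_col_mem //; lia.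
Qed.

(* Predicts long_rows from the word of columns alone: an entry put at the end
   of the highest row of length c.+1 lengthens a row >= t exactly when there is
   a row >= t of that length. *)
Fixpoint greedy_rows w : nat -> nat -> nat :=
  if w is c :: w' then
    let f := greedy_rows w' in
    fun k t => if k == c then
                 if c is c'.+1 then minn (f c t).+1 (f c' t)
                 else f 0 t + (t <= f 0 0)
               else f k t
  else fun _ _ => 0.

(** An entry in column c + 1 raises N(c + 1, t) by at most one, and only when some row from [t] on
    has length c + 1, that is, when N(c + 1, t) < N(c, t). In column 0 the new row is forced. *)
Lemma long_rows_le_greedy h k t : all_steps first_col_step h ->
  long_rows h k t <= greedy_rows (cols h) k t.
Proof.
elim: h k t => //= j h IH k t [st hs]; have {}IH k' t' := IH k' t' hs.
case: (eqVneq k) => [->|kc]; last by rewrite andbF addn0.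
rewrite andbT; case cE : (count_mem j h) => [|c].
  rewrite (first_col_new hs st); first by have := IH 0 t; have := IH 0 0; lia.
  by rewrite -has_pred1 has_count cE.
rewrite leq_min; have := IH c.+1 t; have := IH c t; have := long_rows_leq h c t.
by have /implyP := @introT _ _ (long_rowsP h c t) (ex_intro2 _ _ j _ cE); lia.
Qed.

Lemma young_first_col h : all_steps young_step h -> all_steps first_col_step h.
Proof. by apply: all_steps_sub => j h' []. Qed.

(** Choosing the highest row of the required length makes the bound sharp for every [t] at once. *)
Lemma long_rows_young h k t : all_steps young_step h ->
  long_rows h k t = greedy_rows (cols h) k t.
Proof.
elim: h k t => //= j h IH k t [[st ys] hs]; have {}IH k' t' := IH k' t' hs.
case: (eqVneq k) => [->|kc]; last by rewrite andbF addn0 IH.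
rewrite andbT; case cE : (count_mem j h) => [|c].
  by rewrite (first_col_new (young_first_col hs) st) ?IH // -has_pred1 has_count cE.
rewrite -!IH; case: leqP => tj.
  have := @introT _ _ (long_rowsP h c t) (ex_intro2 _ _ j tj cE); lia.
have: ~~ (long_rows h c.+1 t < long_rows h c t).
  apply/long_rowsP => -[i ti]; rewrite -cE; apply: ys; last lia.
  by rewrite -has_pred1 has_count cE.
by have := long_rows_leq h c t; lia.
Qed.

Lemma greedy_rows_cons c w w' :
  (forall k t, greedy_rows w k t <= greedy_rows w' k t) ->
  forall k t, greedy_rows (c :: w) k t <= greedy_rows (c :: w') k t.
Proof.
move=> le k t /=; case: eqP => // _; case: c => [|c].
  by have := le 0 t; have := le 0 0; lia.
by have := le c.+1 t; have := le c t; lia.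
Qed.

Lemma greedy_rows_neq c w k t : k != c ->
  greedy_rows (c :: w) k t = greedy_rows w k t.
Proof. by move=> /negPf /= ->. Qed.

Lemma greedy_rowsS c w t : greedy_rows (c.+1 :: w) c.+1 t =
  minn (greedy_rows w c.+1 t).+1 (greedy_rows w c t).
Proof. by rewrite /= eqxx. Qed.

Lemma greedy_rows_leq w k t : greedy_rows w k.+1 t <= greedy_rows w k t.
Proof.
elim: w k => // c w IH k; have [->|kc] := eqVneq c k.+1.
  by rewrite greedy_rowsS [leqRHS]greedy_rows_neq ?geq_minr //; lia.
rewrite greedy_rows_neq 1?eq_sym //; have [<-|ck] := eqVneq c k; last first.
  by rewrite greedy_rows_neq // eq_sym.
case: c {kc} => [|c]; first by have := IH 0; rewrite /=; lia.
by have := IH c.+1; have := IH c; rewrite greedy_rowsS; lia.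
Qed.

(** The head of a word is its last insertion, so the right side inserts [c] before [d]. The two
    insertions commute unless [d] is [c] + 1, and then inserting [c] first can only raise the cap
    N(c, t) on the new N(d, t). *)
Lemma greedy_rows_swap c d w k t : c < d ->
  greedy_rows (c :: d :: w) k t <= greedy_rows (d :: c :: w) k t.
Proof.
case: d => // d cd; have [->|kd] := eqVneq k d.+1.
  have dc : d.+1 != c by lia.
  rewrite greedy_rows_neq // !greedy_rowsS greedy_rows_neq //.
  have [<-|dc'] := eqVneq d c; last by rewrite greedy_rows_neq.
  case: d {cd dc} => [|d]; first by rewrite /=; lia.
  by have := greedy_rows_leq w d t; rewrite greedy_rowsS; lia.
rewrite [leqRHS]greedy_rows_neq //; have [->|kc] := eqVneq k c; last first.
  by rewrite !greedy_rows_neq.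
have cd' : c != d.+1 by lia.
case: c cd cd' {k kd} => [|c] cd cd'; first by rewrite /=.
by rewrite !greedy_rowsS !greedy_rows_neq //; lia.
Qed.

(** Given the earlier entries, the column of the last one fixes its row: the highest row of that
    length, or in column 0 the lowest empty row. *)
Lemma young_cols_inj h h' : all_steps young_step h -> all_steps young_step h' ->
  cols h = cols h' -> h = h'.
Proof.
elim: h h' => [|j h IH] [|j' h'] //= [st hs] [st' hs'] [cE /IH]-/(_ hs hs') hh.
subst h'; congr cons; have memE i : (i \in h) = (0 < count_mem i h).
  by rewrite -has_pred1 has_count.
case: st st' => f s [f' s']; have [jj|jj|//] := ltngtP j j'.
  case: (boolP (j \in h)) => jh; first by have := s jh _ jj; rewrite cE.
  by case/negP: (jh); apply: f' => //; rewrite memE -cE -memE.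
case: (boolP (j' \in h)) => jh; first by have := s' jh _ jj; rewrite cE.
by case/negP: (jh); apply: f => //; rewrite memE cE -memE.
Qed.

(** Here the row is the lowest one whose cell in the given column exists and is still empty. *)
Lemma column_cols_inj a h h' :
  all_steps (column_step a) h -> all_steps (column_step a) h' ->
  cols h = cols h' -> h = h'.
Proof.
elim: h h' => [|j h IH] [|j' h'] //= [st hs] [st' hs'] [cE /IH]-/(_ hs hs') hh.
subst h'; congr cons; case: st st' => f s [f' s'].
have [jj|jj|//] := ltngtP j j'.
  by have := s' _ jj; rewrite -cE ltnn => /(_ f).
by have := s _ jj; rewrite cE ltnn => /(_ f').
Qed.

Lemma column_first_col a h : all (leq 1) a ->
  all_steps (column_step a) h -> all_steps first_col_step h.
Proof.
move=> /all_nthP apos; apply: all_steps_sub => j h' [jl jc] jh i ij.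
move: jh; rewrite -!has_pred1 !has_count -leqNgt leqn0 => /eqP j0.
move: jl jc; rewrite j0 => jl /(_ _ ij); apply; apply: apos.
by case: (ltnP j (size a)) => [|/(nth_default 0) ja]; lia.
Qed.

Lemma young_cols_exists h :
  exists2 h', all_steps young_step h' & cols h' = cols h.
Proof.
elim: h => [|j h [h' ys ch]]; first by exists [::].
have fc := young_first_col ys; case cE : (count_mem j h) => [|c].
  have nh : long_rows h' 0 0 \notin h' by rewrite first_col_mem // ltnn.
  exists (long_rows h' 0 0 :: h') => /=.
    split=> //; split=> [_ i|]; first by rewrite first_col_mem.
    by rewrite (negPf nh).
  by rewrite ch cE; congr cons; apply/eqP; rewrite -leqn0 leqNgt -has_count has_pred1.
(* The number of rows of length [c.+1] is N(c, 0) - N(c + 1, 0), which depends on the columns only;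
   so [h'] has such a row because [h] does. *)
have [i0 _ ci0] : exists2 i, 0 <= i & count_mem i h' = c.+1.
  apply/long_rowsP; rewrite !long_rows0 ch -!long_rows0; apply/long_rowsP.
  by exists j.
have [B hB] := history_bound h'.
have ub i : count_mem i h' == c.+1 -> i <= B.
  move=> /eqP ci; apply/ltnW/(allP hB).
  by rewrite -has_pred1 has_count ci.
have ex : exists i, count_mem i h' == c.+1 by exists i0; rewrite ci0.
case: (ex_maxnP ex ub) => i /eqP ci imax.
have ih : i \in h' by rewrite -has_pred1 has_count ci.
exists (i :: h'); rewrite /= ?ch ?ci ?cE //; split=> //; split; first by rewrite /first_col_step ih.
by move=> _ i' ii /eqP; rewrite ci => /imax; lia.
Qed.

(** * Filling the diagram of [a] with a given word of columns *)

Lemma column_cols_closed a h c i j : all_steps (column_step a) h ->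
  i < j -> c < count_mem j h -> c < nth 0 a i -> c < count_mem i h.
Proof.
move=> + ij; elim: h => //= x h IH [[xl xc] /IH{}IH] cj ci.
case: (ltnP c (count_mem j h)) => [/IH/(_ ci)|ltc]; first lia.
have [xj|] := eqVneq x j; last by lia.
subst x; rewrite eqxx add1n ltnS in cj; have cE : count_mem j h = c by apply/anti_leq/andP.
by have := xc _ ij; rewrite cE => /(_ ci) cl; apply: leq_trans cl (leq_addl _ _).
Qed.

Lemma column_count_leq a h i : all_steps (column_step a) h ->
  count_mem i h <= nth 0 a i.
Proof.
elim: h => //= x h IH [[xl _] /IH{}IH].
by case: eqP => [<-|_]; rewrite ?add1n ?add0n.
Qed.

Lemma column_bound a h : all_steps (column_step a) h ->
  all (fun j => j < size a) h.
Proof.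
elim: h => //= x h IH [[xl _] /IH ->]; rewrite andbT ltnNge.
by apply: contraL xl => /(nth_default 0) ->.
Qed.

Lemma long_rows_small h k t : (forall i, i \in h -> i < t) -> long_rows h k t = 0.
Proof.
elim: h => //= x h IH lt; rewrite IH => [|i ih]; last by rewrite lt // inE ih orbT.
by have := lt x (mem_head _ _); lia.
Qed.

Definition long_parts a (k t : nat) := \sum_(t <= j < size a) (k < nth 0 a j).

Lemma long_parts_rows a h k t : (forall j, count_mem j h = nth 0 a j) ->
  long_rows h k t = long_parts a k t.
Proof.
move=> cnt; rewrite (@long_rowsE _ _ _ (size a)); first by apply: eq_bigr => j _; rewrite cnt.
apply/allP => j; rewrite -has_pred1 has_count cnt [j < _]ltnNge.
by apply: contraL => /(nth_default 0) ->.
Qed.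

(** The entries are put one by one into the lowest empty place of their column. Equal column lengths
    guarantee such a place; the other two conditions on [a] guarantee that the place to its left is
    already filled. *)
Lemma column_exists a g :
    all (leq 1) a ->
    (forall i j, i < j -> 1 < nth 0 a i -> 1 < nth 0 a j -> nth 0 a j <= nth 0 a i) ->
    all_steps young_step g ->
    (forall k, long_rows g k 0 = long_parts a k 0) ->
    (forall t, long_parts a 1 t <= long_rows g 1 t) ->
  exists2 h, all_steps (column_step a) h & cols h = cols g.
Proof.
move=> apos adec yg cont dom.
suff [h] : exists2 h, all_steps (column_step a) h & cols h = cols (drop 0 g).
  by rewrite drop0; exists h.
have : g = take 0 g ++ drop 0 g by rewrite cat_take_drop.
(* [cont] and [dom] concern all of [g], so the induction over its final segments [p], which hold the
   earlier entries, keeps the decomposition [g = q ++ p]. *)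
elim: (drop 0 g) (take 0 g) => [|x p IH] q gE; first by exists [::].
have [h ch hp] : exists2 h, all_steps (column_step a) h & cols h = cols p.
  by apply: (IH (rcons q x)); rewrite cat_rcons.
have [xp yp] : young_step x p /\ all_steps young_step p.
  by move: yg; rewrite gE; elim: (q) => //= y r IHr [_ /IHr].
have Nhp k : long_rows h k 0 = long_rows p k 0 by rewrite !long_rows0 hp.
have [c xc] : exists c, count_mem x p = c by exists (count_mem x p).
have hE k t := long_rowsE k t (column_bound ch).
(* Column [c] of [a] has as many cells as that of [g], hence more than that of [h], whose columns
   are those of [p]. *)
have ex : exists j, (c < nth 0 a j) && (count_mem j h <= c).
  have lt : long_rows h c 0 < long_parts a c 0.
    rewrite -cont Nhp gE; have gq : long_rows (x :: p) c 0 <= long_rows (q ++ x :: p) c 0.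
      by elim: (q) => //= y r IHr; lia.
    by apply: leq_trans gq; rewrite /= xc eqxx addn1.
  have [/hasP[j _ ?]|/hasPn no] :=
    boolP (has (fun j => (c < nth 0 a j) && (count_mem j h <= c)) (index_iota 0 (size a))).
    by exists j.
  move: lt; rewrite hE /long_parts ltnNge big_nat_cond [leqRHS]big_nat_cond.
  rewrite leq_sum // => j /andP[jB _].
  by have := no j; rewrite mem_index_iota jB => /(_ isT); lia.
case: (ex_minnP ex) => j /andP[cj jc] jmin.
have {}jmin i : i < j -> c < nth 0 a i -> c < count_mem i h.
  by move=> ij ci; have := jmin i; rewrite ci /= leqNgt => jm; lia.
(* The new cell goes to the lowest row j with an empty place in column c. If
   the place to its left were also empty, then c = 1, as a is decreasing on its
   parts > 1; moreover no row of p would reach j, and the cells of x :: p in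
   column 1 would be too many for dom. *)
suff jE : count_mem j h = c.
  exists (j :: h); last by rewrite /= jE hp xc.
  by split=> //; split; rewrite jE.
apply/eqP; rewrite eqn_leq jc /= leqNgt; apply/negP => jlt.
have [c' cE] : exists c', c = c'.+1 by exists c.-1; lia.
have [j2 _ cj2] : exists2 j2, 0 <= j2 & count_mem j2 h = c.
  rewrite cE; apply/long_rowsP; rewrite !Nhp; apply/long_rowsP.
  by exists x; rewrite // xc cE.
have j2j : j2 < j.
  have [//|jj2|jj2] := ltngtP j2 j; last by rewrite -jj2 cj2 ltnn in jlt.
  have : c' < count_mem j h by apply: (column_cols_closed ch jj2); lia.
  by move: jlt; rewrite cE ltnS leqNgt => /negPf ->.
have aj2 := column_count_leq j2 ch; rewrite cj2 in aj2.
case: c' cE => [|c'] cE; last first.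
  have a2 : 1 < nth 0 a j2 by apply: leq_trans aj2; rewrite cE.
  have aj1 : 1 < nth 0 a j by apply: leq_ltn_trans cj; rewrite cE.
  have cj2a : c < nth 0 a j2 := leq_trans cj (adec _ _ j2j a2 aj1).
  by have := jmin _ j2j cj2a; rewrite cj2 ltnn.
have j0 : j \notin h by rewrite -has_pred1 has_count -leqNgt -ltnS -cE.
have fh := column_first_col apos ch.
have fp := young_first_col yp.
have dj : long_rows p 0 0 <= j by rewrite -Nhp leqNgt -first_col_mem.
have xj : x < j.
  by apply: leq_trans dj; rewrite -first_col_mem // -has_pred1 has_count xc cE.
have := long_rows_cat (x :: p) q 1 j; rewrite -gE /= xc cE [j <= x]leqNgt xj /= addn0 addn1.
rewrite (@long_rows_small p 1 j) => [|i]; last first.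
  by rewrite first_col_mem // => /leq_trans; apply.
have := dom j; rewrite cont -Nhp hE /long_parts.
have jsz : j <= size a.
  by apply: contraTT cj; rewrite -ltnNge => /ltnW/(nth_default 0) ->.
have split F :
  \sum_(0 <= i < size a) F i =
  \sum_(0 <= i < j) F i + \sum_(j <= i < size a) F i :> nat := big_cat_nat (leq0n j) jsz.
(* By [jmin] every place of column 1 below row [j] is filled in [h]. All cells of [x :: p] in column
   1 lie below row [j], one more than there are such places, while [dom] and [cont] leave room for
   no more than these places. *)
rewrite !split; have : \sum_(0 <= i < j) (1 < nth 0 a i) <= \sum_(0 <= i < j) (1 < count_mem i h).
  rewrite big_nat_cond [leqRHS]big_nat_cond; apply: leq_sum => i /andP[/andP[_ ij] _].
  have := jmin _ ij; rewrite cE.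
  by case: (1 < nth 0 a i) => // /(_ isT) ->.
lia.
Qed.

End Histories.

(** * Fillings and histories *)

(** [f] gives the row of each entry; the histories of all initial segments of a filling share one
    [f]. *)
Fixpoint history (f : nat -> nat) (k : nat) : seq nat :=
  if k is k'.+1 then f k' :: history f k' else [::].

Lemma size_history f k : size (history f k) = k.
Proof. by elim: k => //= k ->. Qed.

Lemma eq_history f g k : (forall l, l < k -> f l = g l) -> history f k = history g k.
Proof.
by elim: k => //= k IH fg; rewrite fg // IH // => l lk; rewrite fg // ltnW.
Qed.

Lemma history_inj f g k l : history f k = history g k -> l < k -> f l = g l.
Proof.
elim: k => //= k IH [fg /IH{}IH]; rewrite ltnS leq_eqVlt => /orP[/eqP->|/IH] //.
Qed.

Lemma history_eq f g k l : history f k = history g k -> l <= k -> history f l = history g l.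
Proof. by move=> fg lk; apply: eq_history => i il; apply: (history_inj fg); lia. Qed.

Lemma history_of h : exists f, history f (size h) = h.
Proof.
exists (fun k => nth 0 (rev h) k); elim: h => //= j h IH.
rewrite rev_cons nth_rcons size_rev ltnn eqxx; congr cons; rewrite -[RHS]IH.
by apply: eq_history => l lh; rewrite nth_rcons size_rev lh.
Qed.

Lemma all_steps_history P f n : all_steps P (history f n) <->
  forall k, k < n -> P (f k) (history f k).
Proof.
elim: n => //= n IH; split=> [[p /IH ps] k|ps].
  by rewrite ltnS leq_eqVlt => /orP[/eqP->|/ps].
by split; [exact: ps | apply/IH => k kn; apply: ps; lia].
Qed.

Lemma cols_history f n :
  cols (history f n) = history (fun k => count_mem (f k) (history f k)) n.
Proof. by elim: n => //= n ->. Qed.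

Lemma count_history_leq f j l k : l <= k ->
  count_mem j (history f l) <= count_mem j (history f k).
Proof.
elim: k => [|k IH]; first by rewrite leqn0 => /eqP ->.
by rewrite leq_eqVlt => /orP[/eqP-> // | /IH] /= le; apply: leq_trans le (leq_addl _ _).
Qed.

Section Fillings.
Variables (n : nat) (a : intcomp n).
Implicit Types (T : filling n a) (c d : cell a) (f g : nat -> nat).

Lemma intcomp_pos : all (leq 1) a.
Proof. by have /andP[] := intcompP a. Qed.

Lemma intcomp_sum : sumn a = n.
Proof. by have /andP[_ /eqP] := intcompP a. Qed.

Lemma crow_ltn c : crow c < size a.
Proof. exact: ltn_ord. Qed.

Lemma ccol_ltn c : ccol c < nth 0 a (crow c).
Proof. exact: ltn_ord. Qed.

Lemma cell_inj c d : crow c = crow d -> ccol c = ccol d -> c = d.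
Proof.
case: c d => [i x] [j y]; rewrite /crow /ccol /= => /val_inj ij; subst j.
by move=> /val_inj ->.
Qed.

Lemma cell_exists i j : j < nth 0 a i -> exists c, crow c = i /\ ccol c = j.
Proof.
move=> ja; have ia : i < size a.
  by rewrite ltnNge; apply: contraL ja => /(nth_default 0) ->.
by exists (@Tagged _ (Ordinal ia) (fun i : 'I_(size a) => 'I_(nth 0 a i)) (Ordinal ja)).
Qed.

Lemma card_cell : #|{: cell a}| = n.
Proof.
rewrite card_tagged -[RHS]intcomp_sum; congr sumn.
rewrite (eq_map (g := nth 0 a \o val)) => [|i /=]; last by rewrite card_ord.
by rewrite map_comp val_enum_ord -/(mkseq _ _) mkseq_nth.
Qed.

Definition row_history T (f : nat -> nat) :=
  forall c, f (T c) = crow c /\ count_mem (crow c) (history f (T c)) = ccol c.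

Lemma entry_cell T (k : 'I_n) : is_standard T -> exists c, T c = k.
Proof.
move=> /forallP/(_ k)/cards1P[c cE]; exists c.
by apply/eqP; have := set11 c; rewrite -cE inE.
Qed.

Lemma standard_inj T : is_standard T -> injective T.
Proof.
move=> /forallP st c d cd; have /cards1P[e eE] := st (T c).
have : c \in [set c' | T c' == T c] by rewrite inE.
have : d \in [set c' | T c' == T c] by rewrite inE cd.
by rewrite !eE !inE => /eqP-> /eqP->.
Qed.

Lemma standardP T : injective T -> is_standard T.
Proof.
move=> inj; apply/forallP => k.
have /codomP[c ->] : k \in codom T by apply: inj_card_onto; rewrite // card_cell card_ord.
apply/cards1P; exists c; apply/setP => d; rewrite !inE.
exact: inj_eq.
Qed.

Lemma count_rows T f j l : is_standard T -> (forall c, f (T c) = crow c) ->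
  l <= n -> count_mem j (history f l) = #|[set c | (crow c == j) && (T c < l)]|.
Proof.
move=> st fT; elim: l => [|l IH] ln /=.
  by apply/esym/eqP; rewrite cards_eq0; apply/eqP/setP => c; rewrite !inE andbF.
have [d dl] := entry_cell (Ordinal ln) st.
have {dl} dl : T d = l :> nat by rewrite dl.
have lE c : (T c == l :> nat) = (c == d).
  by rewrite -dl val_eqE (inj_eq (standard_inj st)).
rewrite IH 1?ltnW // -dl fT dl; case: (eqVneq (crow d) j) => cj /=; last first.
  apply: eq_card => c; rewrite !inE ltnS [T c <= l]leq_eqVlt lE.
  by case: (eqVneq c d) => [->|] //=; rewrite (negPf cj).
rewrite -[RHS](_ : #|d |: [set c | (crow c == j) && (T c < l)]| = _).
  by rewrite cardsU1 inE dl ltnn andbF.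
apply: eq_card => c; rewrite !inE ltnS [T c <= l]leq_eqVlt lE.
by case: (eqVneq c d) => [->|] //=; rewrite cj eqxx.
Qed.

Lemma card_row_prefix j m : m <= nth 0 a j ->
  #|[set c : cell a | (crow c == j) && (ccol c < m)]| = m.
Proof.
move=> mj; rewrite -[RHS](size_iota 0 m) cardE -(size_map (@ccol a)).
apply/perm_size/uniq_perm; rewrite ?iota_uniq //.
  rewrite map_inj_in_uniq ?enum_uniq // => c d; rewrite !mem_enum !inE.
  by move=> /andP[/eqP cj _] /andP[/eqP dj _]; apply: cell_inj; rewrite cj dj.
move=> x; rewrite mem_iota /= add0n; apply/mapP/idP => [[c]|xm].
  by rewrite mem_enum inE => /andP[_ cm] ->.
have [c [cj cx]] := cell_exists (leq_trans xm mj).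
by exists c; rewrite // mem_enum inE cj cx eqxx.
Qed.

Lemma row_history_exists T : is_standard T -> rows_increasing T ->
  exists f, row_history T f.
Proof.
move=> st /forallP rows; have [pos posK] := fin_all_exists (fun k => entry_cell k st).
pose f k := if insub k is Some o then crow (pos o) else 0.
have fT c : f (T c) = crow c.
  by rewrite /f valK; congr crow; apply: (standard_inj st).
exists f => c; split=> //; rewrite (count_rows _ st fT) 1?ltnW //.
rewrite -[RHS](@card_row_prefix (crow c)) 1?ltnW ?ccol_ltn //.
apply: eq_card => d; rewrite !inE; case: eqP => //= dc.
have rowsE x y : crow x = crow y -> ccol x < ccol y -> T x < T y.
  by move=> xy lt; have /forallP/(_ y)/implyP := rows x; apply; rewrite xy eqxx.
have [lt|lt|eq] := ltngtP (ccol d) (ccol c); first exact: rowsE.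
- by apply/negbTE; rewrite -leqNgt ltnW // rowsE.
- by rewrite (cell_inj dc eq) ltnn.
Qed.

Section RowHistory.
Variables (T : filling n a) (f : nat -> nat).
Hypotheses (st : is_standard T) (rT : row_history T f).

(** Turns comparisons of entries into comparisons of row lengths, which is how tableau conditions
    become conditions on the steps. *)
Lemma entry_ltn c l : (T c < l) = (ccol c < count_mem (crow c) (history f l)).
Proof.
have [fT cT] := rT c; case: ltnP => Tl.
  have := count_history_leq f (crow c) Tl.
  by rewrite /= fT eqxx cT => ->.
by apply/esym/negbTE; rewrite -leqNgt -[leqRHS]cT count_history_leq.
Qed.

Lemma row_history_content j : count_mem j (history f n) = nth 0 a j.
Proof.
rewrite (count_rows _ st) // => [|c]; last by have [] := rT c.
rewrite -[RHS](@card_row_prefix j) //; apply: eq_card => c; rewrite !inE ltn_ord.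
by case: eqP => //= <-; rewrite ccol_ltn.
Qed.

Lemma entry_col_history (k : 'I_n) : entry_col T k = count_mem (f k) (history f k).
Proof.
have [c cT] := entry_cell k st; have [fT cnt] := rT c.
by rewrite (entry_colE st cT) -cnt -fT cT.
Qed.

Lemma row_history_rows : rows_increasing T.
Proof.
apply/forallP => c; apply/forallP => d; apply/implyP => /andP[/eqP cd lt].
by rewrite entry_ltn cd; have [_ ->] := rT d.
Qed.

Lemma columns_increasingP :
  columns_increasing T <-> all_steps (column_step a) (history f n).
Proof.
split=> [/forallP cols|/all_steps_history cols].
  apply/all_steps_history => k kn; have [c cT] := entry_cell (Ordinal kn) st.
  have {}cT : T c = k :> nat by rewrite cT.
  have [fT cnt] := rT c; rewrite -cT fT /column_step cnt; split; first exact: ccol_ltn.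
  move=> i ic ci; have [d [di dc]] := cell_exists ci.
  have /forallP/(_ c)/implyP := cols d; rewrite dc di eqxx => /(_ ic).
  by rewrite entry_ltn dc di.
apply/forallP => c; apply/forallP => d; apply/implyP => /andP[/eqP cd lt].
have [fT cnt] := rT d; have [_] := cols _ (ltn_ord (T d)); rewrite fT cnt => st'.
by rewrite entry_ltn cd st' // -cd ccol_ltn.
Qed.

(** When the entry of a cell [c] is inserted, its row has length [ccol c]. A smaller entry one
    column to the left in a higher row says that this row is at least as long, and the triple
    condition that it is then strictly longer. *)
Lemma young_tableauP : first_column_increasing T && young_triple T <->
  all_steps young_step (history f n).
Proof.
split=> [/andP[/forallP fcol /forallP tri]|/all_steps_history steps].
  apply/all_steps_history => k kn; have [c cT] := entry_cell (Ordinal kn) st.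
  have {}cT : T c = k :> nat by rewrite cT.
  have [fT cnt] := rT c; rewrite -cT fT; split.
    rewrite /first_col_step -!has_pred1 has_count cnt -leqNgt leqn0 => /eqP c0 i ic.
    have [d [di dc]] : exists d, crow d = i /\ ccol d = 0.
      by apply: cell_exists; have /all_nthP := intcomp_pos; apply; apply: ltn_trans ic (crow_ltn c).
    have /forallP/(_ c)/implyP := fcol d; rewrite dc di c0 /= => /(_ ic).
    by rewrite entry_ltn dc di -has_count has_pred1.
  rewrite cnt -has_pred1 has_count cnt => c0 i ci ic.
  have cntle : count_mem i (history f (T c)) <= nth 0 a i.
    by rewrite -row_history_content count_history_leq // ltnW.
  (* [d] is the last cell of row [i] at the time when [T c] is inserted. *)
  have [d [di dc]] : exists d, crow d = i /\ ccol d = (ccol c).-1.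
    by apply: cell_exists; apply: leq_trans cntle; rewrite ic prednK.
  have Tdc : T d < T c by rewrite entry_ltn di dc ic prednK.
  have /forallP/(_ d)/implyP := tri c; rewrite dc di prednK // eqxx ci (ltnW Tdc).
  move=> /(_ isT)/existsP[e /and3P[/eqP ed /eqP ec]].
  by rewrite entry_ltn ed ec ic ltnn.
apply/andP; split; apply/forallP => c; apply/forallP => d; apply/implyP => /and3P[].
  move=> /eqP c0 /eqP d0 cd; have [fT cnt] := rT d.
  have [fs _] := steps _ (ltn_ord (T d)); rewrite fT in fs.
  rewrite entry_ltn c0 -has_count has_pred1; apply: fs => //.
  by rewrite -has_pred1 has_count cnt d0.
move=> /eqP cd lt dc; have [fT cnt] := rT c.
have {}dc : T d < T c.
  rewrite ltn_neqAle dc andbT; apply: contraTneq lt => /val_inj/(standard_inj st) ->.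
  by rewrite ltnn.
have [_] := steps _ (ltn_ord (T c)); rewrite fT cnt -has_pred1 has_count cnt cd.
move=> /(_ isT _ lt) ne; have := dc; rewrite entry_ltn leq_eqVlt eq_sym => /orP[/eqP //|ge].
have cntle : count_mem (crow d) (history f (T c)) <= nth 0 a (crow d).
  by rewrite -row_history_content count_history_leq // ltnW.
have [e [ed ec]] := cell_exists (leq_trans ge cntle).
by apply/existsP; exists e; rewrite ed ec eqxx entry_ltn ed ec eqxx.
Qed.

End RowHistory.

(** Each entry is sent to the cell that it adds. This map is injective between sets of size [n], and
    the filling is its inverse. *)
Lemma filling_of_history f : (forall j, count_mem j (history f n) = nth 0 a j) ->
  exists2 T, is_standard T & row_history T f.
Proof.
move=> cnt; have posE (k : 'I_n) : exists c : cell a,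
    crow c = f k /\ ccol c = count_mem (f k) (history f k).
  apply: cell_exists; rewrite -cnt.
  by apply: leq_trans (count_history_leq f (f k) (ltn_ord k)); rewrite /= eqxx.
have [pos posP] := fin_all_exists posE.
have pos_lt (k l : 'I_n) : k < l -> pos k != pos l.
  move=> kl; apply/eqP => eq; have [kr kc] := posP k; have [lr lc] := posP l.
  have fkl : f k = f l by rewrite -kr -lr eq.
  by have := count_history_leq f (f k) kl; rewrite /= eqxx -kc fkl -lc eq ltnn.
have pos_inj : injective pos.
  move=> k l kl; apply: val_inj; have [/pos_lt|/pos_lt|//] := ltngtP k l.
    by rewrite kl eqxx.
  by rewrite kl eqxx.
have [|g posK gK] := inj_card_bij pos_inj; first by rewrite card_cell card_ord.
exists [ffun c => g c]; first by apply: standardP => c d; rewrite !ffunE => /(can_inj gK).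
by move=> c; rewrite ffunE; have [kr kc] := posP (g c); rewrite gK in kr kc; rewrite kr kc.
Qed.

Lemma row_history_inj T T' f g : is_standard T' ->
  row_history T f -> row_history T' g -> history f n = history g n -> T = T'.
Proof.
move=> st' rT rT' fg; apply/ffunP => c; have [fT cT] := rT c.
have [d dT] := entry_cell (T c) st'; have [gT dc] := rT' d.
rewrite -dT; congr (T' _); apply/esym/cell_inj.
  by rewrite -fT -gT dT (history_inj fg).
by rewrite -cT -dc -fT -gT dT (history_inj fg) ?(history_eq fg) // ltnW.
Qed.

End Fillings.

(** * Tableaux with the same columns *)

Lemma sumn_count_mem (h : seq nat) m : all (fun j => j < m) h ->
  \sum_(0 <= j < m) count_mem j h = size h.
Proof.
elim: h => [|x h IH] /=; first by rewrite big1.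
move=> /andP[xm /IH{}IH]; rewrite big_split /= IH -add1n; congr (_ + _).
rewrite (bigD1_seq x) ?mem_index_iota ?iota_uniq //= eqxx big1 // => i.
by rewrite eq_sym => /negPf ->.
Qed.

Lemma size_leq_sumn (s : seq nat) : all (leq 1) s -> size s <= sumn s.
Proof. by elim: s => //= x s IH /andP[x0 /IH]; lia. Qed.

Lemma nth_leq_sumn (s : seq nat) j : nth 0 s j <= sumn s.
Proof. by elim: s j => [|x s IH] [|j] //=; rewrite ?leq_addr //; have := IH j; lia. Qed.

(** * Compositions compared through their numbers N(k, t) *)

Lemma eq_composition (s s' : seq nat) : all (leq 1) s -> all (leq 1) s' ->
  (forall j, nth 0 s j = nth 0 s' j) -> s = s'.
Proof.
have le (u v : seq nat) : all (leq 1) u -> (forall j, nth 0 u j = nth 0 v j) -> size u <= size v.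
  move=> /all_nthP u1 uv; rewrite leqNgt; apply/negP => lt.
  by have := u1 0 _ lt; rewrite uv nth_default.
move=> s1 s1' ss; apply: (@eq_from_nth _ 0) => [|j _]; last exact: ss.
by apply/eqP; rewrite eqn_leq !le.
Qed.

Lemma long_parts_default (s : seq nat) k t : size s <= t -> long_parts s k t = 0.
Proof. by move=> st; rewrite /long_parts big_geq. Qed.

Lemma long_partsS (s : seq nat) k t :
  long_parts s k t = (k < nth 0 s t) + long_parts s k t.+1.
Proof.
rewrite /long_parts; have [ts|st] := ltnP t (size s); first by rewrite big_ltn.
by rewrite nth_default // !big_geq // leqW.
Qed.

Lemma eq_long_parts (s s' : seq nat) : all (leq 1) s -> all (leq 1) s' ->
  (forall k t, long_parts s k t = long_parts s' k t) -> s = s'.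
Proof.
move=> s1 s1' ss; apply: eq_composition => // j.
have lt k : (k < nth 0 s j) = (k < nth 0 s' j).
  have := ss k j; rewrite !(long_partsS _ _ j) ss => /eqP.
  by rewrite eqn_add2r; do 2!case: (_ < _).
by apply/anti_leq/andP; split; rewrite leqNgt; [rewrite lt ltnn | rewrite -lt ltnn].
Qed.

Definition weight n (s : seq nat) := \sum_(p : 'I_n * 'I_n) long_parts s p.1 p.2.

(** Termwise comparable sums can only agree if all terms do. Outside the range of [weight] the terms
    vanish, as a composition of [n] has at most [n] parts, each at most [n]; and the N(k, t)
    determine the composition. *)
Lemma weight_lt n (s s' : seq nat) : is_comp n s -> is_comp n s' ->
    (forall k t, long_parts s k t <= long_parts s' k t) ->
  weight n s < weight n s' \/ s = s'.
Proof.
move=> /andP[s1 /eqP sn] /andP[s1' /eqP sn'] le.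
have := leqif_sum (P := predT) (fun (p : 'I_n * 'I_n) _ => leqif_eq (le p.1 p.2)).
rewrite -/(weight n s) -/(weight n s') => -[ws wE].
have [eqw|neqw] := eqVneq (weight n s) (weight n s'); last by left; rewrite ltn_neqAle neqw.
have {wE} /forallP eq := etrans (esym wE) (introT eqP eqw).
right; apply: eq_long_parts => // k t.
have [kn|nk] := ltnP k n; last first.
  rewrite /long_parts !big1 // => j _; apply/eqP; rewrite eqb0 -leqNgt.
    by apply: leq_trans nk; rewrite -sn' nth_leq_sumn.
  by apply: leq_trans nk; rewrite -sn nth_leq_sumn.
have [tn|nt] := ltnP t n; first exact: (eqP (eq (Ordinal kn, Ordinal tn))).
rewrite !long_parts_default //; apply: leq_trans nt.
  by rewrite -sn' size_leq_sumn.
by rewrite -sn size_leq_sumn.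
Qed.

(** The exchange itself is [greedy_rows_swap]; later letters are added by monotonicity. *)
Lemma greedy_rows_history (u v : nat -> nat) i m k t :
    u i.+1 < u i -> v i = u i.+1 -> v i.+1 = u i ->
    (forall l, l != i -> l != i.+1 -> v l = u l) -> i.+1 < m ->
  greedy_rows (history u m) k t <= greedy_rows (history v m) k t.
Proof.
move=> ui vi vi1 vu; elim: m k t => // m IH k t.
rewrite ltnS leq_eqVlt => /orP[/eqP <-|im].
  rewrite [history u _]/= [history v _]/= vi vi1 (_ : history v i = history u i).
    exact: greedy_rows_swap.
  by apply: eq_history => l li; apply: vu; lia.
rewrite [history u _]/= [history v _]/= (vu m) ?gtn_eqF //; last by lia.
by apply: greedy_rows_cons => k' t'; apply: IH.
Qed.

(** * Passing between SET(a) and SYCT(b) through the word of columns *)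

Section ColumnWords.
Variable n : nat.
Implicit Types (a b : intcomp n).

Definition same_columns a b (T : filling n a) (U : filling n b) :=
  forall k, entry_col T k = entry_col U k.

Definition column_word a (T : filling n a) (k : nat) : nat :=
  if insub k is Some o then entry_col T o else 0.

Lemma column_wordE a (T : filling n a) (k : 'I_n) : column_word T k = entry_col T k.
Proof. by rewrite /column_word valK. Qed.

Lemma cols_column_word a (T : filling n a) f : is_standard T -> row_history T f ->
  cols (history f n) = history (column_word T) n.
Proof.
move=> st rT; rewrite cols_history; apply: eq_history => l ln.
by rewrite (column_wordE T (Ordinal ln)) (entry_col_history st rT).
Qed.

Lemma same_columnsP a b (T : filling n a) (U : filling n b) f g :
    is_standard T -> row_history T f -> is_standard U -> row_history U g ->
  same_columns T U <-> cols (history f n) = cols (history g n).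
Proof.
move=> sT rT sU rU; rewrite (cols_column_word sT rT) (cols_column_word sU rU).
split=> [TU|TU k]; last by rewrite -!column_wordE (history_inj TU).
by apply: eq_history => l ln; rewrite !(column_wordE _ (Ordinal ln)).
Qed.

Lemma SET_history a (T : filling n a) : is_SET T ->
  exists f, row_history T f /\ all_steps (column_step a) (history f n).
Proof.
move=> /and3P[st rows colsT]; have [f rT] := row_history_exists st rows.
by exists f; split=> //; apply/(columns_increasingP st rT).
Qed.

Lemma SYCT_history b (U : filling n b) : is_SYCT U ->
  exists f, row_history U f /\ all_steps young_step (history f n).
Proof.
move=> /and4P[st rows fcol tri]; have [f rU] := row_history_exists st rows.
by exists f; split=> //; apply/(young_tableauP st rU); rewrite fcol tri.
Qed.

Lemma SET_same_columns a (T T' : filling n a) :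
  is_SET T -> is_SET T' -> same_columns T T' -> T = T'.
Proof.
move=> sT sT'; have [f [rT cT]] := SET_history sT; have [g [rT' cT']] := SET_history sT'.
case/and3P: sT sT' => sT _ _ /and3P[sT' _ _] /(same_columnsP sT rT sT' rT') fg.
exact: row_history_inj sT' rT rT' (column_cols_inj cT cT' fg).
Qed.

Lemma SYCT_same_columns b (U U' : filling n b) :
  is_SYCT U -> is_SYCT U' -> same_columns U U' -> U = U'.
Proof.
move=> sU sU'; have [f [rU yU]] := SYCT_history sU; have [g [rU' yU']] := SYCT_history sU'.
case/and4P: sU sU' => sU _ _ _ /and4P[sU' _ _ _] /(same_columnsP sU rU sU' rU') fg.
exact: row_history_inj sU' rU rU' (young_cols_inj yU yU' fg).
Qed.

Lemma SYCT_shape b b' (U : filling n b) (U' : filling n b') :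
  is_SYCT U -> is_SYCT U' -> same_columns U U' -> b = b'.
Proof.
move=> sU sU'; have [f [rU yU]] := SYCT_history sU; have [g [rU' yU']] := SYCT_history sU'.
case/and4P: sU sU' => sU _ _ _ /and4P[sU' _ _ _] /(same_columnsP sU rU sU' rU') fg.
apply: intcomp_inj; apply: eq_composition (intcomp_pos b) (intcomp_pos b') _ => j.
by rewrite -(row_history_content sU rU) -(row_history_content sU' rU') (young_cols_inj yU yU' fg).
Qed.

(** The parts of [b] are the row lengths of the Young history with the columns of [T]; they are
    positive because the nonempty rows form an initial segment. *)
Lemma SET_SYCT a (T : filling n a) : is_SET T ->
  exists (b : intcomp n) (U : filling n b), is_SYCT U /\ same_columns T U.
Proof.
move=> sT; have [f [rT cT]] := SET_history sT; case/and3P: (sT) => stT _ _.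
have [h yh hE] := young_cols_exists (history f n).
have szh : size h = n by rewrite -size_cols hE size_cols size_history.
have fh := young_first_col yh; set d := long_rows h 0 0.
pose s := [seq count_mem j h | j <- iota 0 d].
have hs : all (fun j => j < d) h by apply/allP => j; rewrite (first_col_mem _ fh).
have nth_s j : nth 0 s j = count_mem j h.
  have [jd|dj] := ltnP j d; first by rewrite (nth_map 0) ?size_iota // nth_iota.
  rewrite nth_default ?size_map ?size_iota //; apply/esym/eqP.
  by rewrite -leqn0 leqNgt -has_count has_pred1 first_col_mem // -leqNgt.
have bP : is_comp n s.
  apply/andP; split; last first.
    by rewrite sumnE big_map -szh -(sumn_count_mem hs) /index_iota subn0.
  apply/allP => x /mapP[j]; rewrite mem_iota add0n => /= jd ->.
  by rewrite -has_count has_pred1 first_col_mem.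
have [g gE] := history_of h; rewrite szh in gE.
have [U sU rU] := @filling_of_history n (IntComp bP) g
  (fun j => etrans (congr1 _ gE) (esym (nth_s j))).
exists (IntComp bP), U; split; last by apply/(same_columnsP stT rT sU rU); rewrite gE hE.
have := (young_tableauP sU rU).2; rewrite gE => /(_ yh) yU.
by rewrite /is_SYCT sU (row_history_rows rU) yU.
Qed.

Definition hook_decreasing (a : seq nat) :=
  forall i j, i < j -> 1 < nth 0 a i -> 1 < nth 0 a j -> nth 0 a j <= nth 0 a i.

(** The conditions of [column_exists] on a Young history only involve its numbers N(k, t), hence
    only its shape; so they pass from [U] to [U']. *)
Lemma SYCT_SET a b (T : filling n a) (U U' : filling n b) :
    hook_decreasing a -> is_SET T -> is_SYCT U -> same_columns T U -> is_SYCT U' ->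
  exists T' : filling n a, is_SET T' /\ same_columns T' U'.
Proof.
move=> adec sT sU TU sU'; have [f [rT cT]] := SET_history sT.
have [g [rU yU]] := SYCT_history sU; have [g' [rU' yU']] := SYCT_history sU'.
case/and3P: sT => sT _ _; case/and4P: sU => sU _ _ _; case/and4P: sU' => sU' _ _ _.
have fg := (same_columnsP sT rT sU rU).1 TU.
have aE k t : long_parts a k t = long_rows (history f n) k t.
  by apply/esym/long_parts_rows; apply: row_history_content sT rT.
have bE k t : long_rows (history g n) k t = long_rows (history g' n) k t.
  by rewrite (long_parts_rows _ _ (row_history_content sU rU))
    (long_parts_rows _ _ (row_history_content sU' rU')).
have [|t|h ch hE] := column_exists (intcomp_pos a) adec yU'.
- by move=> k; rewrite aE -bE !long_rows0 fg.
(* N(1, t) for [a] is bounded by the greedy value for the columns of [T], which is exact for [U]. *)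
- rewrite aE -bE (long_rows_young _ _ yU) -fg.
  exact/long_rows_le_greedy/(column_first_col (intcomp_pos a)).
have szh : size h = n by rewrite -size_cols hE size_cols size_history.
have cnt j : count_mem j h = nth 0 a j.
  (* No row of [h] exceeds its part of [a] and both totals are [n], so every row is full. *)
  have := leqif_sum (P := predT) (fun (i : 'I_(size a)) _ => leqif_eq (column_count_leq i ch)).
  case=> _; rewrite -(big_mkord predT (fun i => count_mem i h)) sumn_count_mem ?column_bound //.
  rewrite -(big_mkord predT (nth 0 a)) szh -{1}(intcomp_sum a) sumnE (big_nth 0) eqxx.
  move=> /esym/forallP eq; have [ja|aj] := ltnP j (size a).
    exact: (eqP (eq (Ordinal ja))).
  rewrite nth_default //; apply/eqP; rewrite -leqn0.
  by rewrite (leq_trans (column_count_leq j ch)) // nth_default.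
have [f' f'E] := history_of h; rewrite szh in f'E.
have [T' sT' rT'] := @filling_of_history n a f' (fun j => etrans (congr1 _ f'E) (cnt j)).
exists T'; split; last by apply/(same_columnsP sT' rT' sU' rU'); rewrite f'E.
have := (columns_increasingP sT' rT').2; rewrite f'E => /(_ ch) cT'.
by rewrite /is_SET sT' (row_history_rows rT').
Qed.

(** The swap moves the smaller column to the earlier entry, which weakly raises the greedy values;
    for Young tableaux these are the N(k, t) of the shape. *)
Lemma SYCT_swap a b b' (i : 'I_n.-1) (T : filling n a) (U : filling n b) (U' : filling n b') :
    entry_col T (entry_hi i) < entry_col T (entry_lo i) ->
    is_SYCT U -> same_columns T U ->
    is_SYCT U' -> same_columns (swap_entries i T) U' ->
  weight n b < weight n b' \/ b = b' :> seq nat.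
Proof.
move=> lt sU TU sU' TU'; have [g [rU yU]] := SYCT_history sU.
have [g' [rU' yU']] := SYCT_history sU'.
case/and4P: sU => sU _ _ _; case/and4P: sU' => sU' _ _ _.
apply: weight_lt; rewrite ?intcompP // => k t.
have bE := @long_parts_rows b _ k t (row_history_content sU rU).
have bE' := @long_parts_rows b' _ k t (row_history_content sU' rU').
rewrite -bE -bE' !long_rows_young // (cols_column_word sU rU) (cols_column_word sU' rU').
have lo : column_word U i = entry_col T (entry_lo i) by rewrite (column_wordE U (entry_lo i)) TU.
have hi : column_word U i.+1 = entry_col T (entry_hi i) by rewrite (column_wordE U (entry_hi i)) TU.
apply: (@greedy_rows_history _ _ i); rewrite ?lo ?hi ?ltn_ord_pred //.
- by rewrite (column_wordE U' (entry_lo i)) -TU' entry_col_swap tpermL.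
- by rewrite (column_wordE U' (entry_hi i)) -TU' entry_col_swap tpermR.
move=> l li li1; have [ln|nl] := ltnP l n; last by rewrite /column_word !insubF // ltnNge nl.
rewrite !(column_wordE _ (Ordinal ln)) -TU -TU' entry_col_swap tpermD //.
  by rewrite -val_eqE /= eq_sym.
by rewrite -val_eqE /= eq_sym.
Qed.

End ColumnWords.

(** The inserted letters are ones, so the parts of [a] exceeding 1 are those of [lam], in the same
    order. *)
Lemma shuffle_hook_decreasing lam k a : is_part lam -> is_shuffle lam (nseq k 1) a ->
  hook_decreasing a.
Proof.
move=> /andP[srt _] [m [sz mE oE]].
have fE : [seq x <- a | 1 < x] = [seq x <- lam | 1 < x].
  rewrite -mE; elim: a m k sz oE {mE} => [|x a IH] [|b m] //= k [sz].
  case: b => /= oE; first by rewrite (IH m k).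
  by case: k oE => // k [-> /(IH m k sz) ->].
have : pairwise geq [seq x <- a | 1 < x].
  by rewrite fE -sorted_pairwise ?sorted_filter // => x y z /= *; lia.
elim: a {m sz mE oE fE} => [|x a IH] /=; first by move=> _ i j; rewrite !nth_nil.
case: ifP => [x1 /andP[/allP le /IH dec]|x1 /IH dec] [|i] [|j] //= ij.
- move=> _ j1; apply: le; rewrite mem_filter j1 mem_nth // ltnNge.
  by apply: contraL j1 => /(nth_default 0) ->.
- exact: dec.
- by rewrite x1.
- exact: dec.
Qed.

(** * Filtrations *)

Section Flags.
Local Open Scope ring_scope.

Lemma mem_span_vsval (K : fieldType) (V : vectType K) (U : {vspace V})
    (X : seq (subvs_of U)) u :
  (vsval u \in <<map vsval X>>%VS) = (u \in <<X>>%VS).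
Proof.
have -> : map vsval X = map (linfun (vsval : subvs_of U -> V)) X.
  by apply: eq_map => w; rewrite lfunE.
rewrite -limg_span; apply/memv_imgP/idP => [[w wX]|uX].
  by rewrite lfunE => /subvs_inj ->.
by exists u; rewrite ?lfunE.
Qed.

Variables (R : realType) (n : nat).
Local Notation C := (complex R).

(** Induction on [s]: the span of the tail is a submodule, and the coordinate along the first vector
    maps [M] onto a simple module with that span as kernel. *)
Lemma ch_eq_flag (M : hmodule R n) (I : eqType) (e : I -> M) (d : I -> intcomp n)
    (s : seq I) :
    basis_of fullv (map e s) ->
    (forall s1 x s2 i, s = s1 ++ x :: s2 ->
       hm_pi M i (e x) - (i \notin cset (d x))%:R *: e x \in <<map e s2>>%VS) ->
  ch_eq M (fun m => \sum_(x <- s) fundamental R (d x) m).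
Proof.
elim: s M e => [|x s IH] M e bas tri.
  rewrite (_ : (fun m => _) = fun=> 0); last by apply: funext => m; rewrite big_nil.
  by apply: ch_eq_zero; have := size_basis bas; rewrite /= => ->.
set U := <<map e s>>%VS.
have eU y : y \in s -> e y \in U by move=> ys; apply/memv_span/map_f.
have US i v : v \in U -> hm_pi M i v \in U.
  move=> vU; suff /subvP sub : (hm_pi M i @: U <= U)%VS by apply/sub/memv_img.
  rewrite limg_span; apply/span_subvP => _ /mapP[_ /mapP[y ys ->] ->].
  have [s1 [s2 sE]] : exists s1 s2, s = s1 ++ y :: s2.
    by case/splitPr: ys => s1 s2; exists s1, s2.
  rewrite -[hm_pi M i _](subrK ((i \notin cset (d y))%:R *: e y)).
  apply: memvD; last exact/memvZ/eU.
  have := tri (x :: s1) y s2 i; rewrite /= -sE => /(_ erefl).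
  suff /subvP sub : (<<map e s2>> <= U)%VS by apply: sub.
  apply: sub_span => w /mapP[z zs ->]; apply: map_f.
  by rewrite sE mem_cat inE zs !orbT.
pose W := Submodule US.
have bas' := bas; move: bas'; rewrite /basis_of /= free_cons -/U.
case/andP=> /eqP spanE /andP[exU fr].
pose e' y : sub_module W := vsproj U (e y).
have e'K : {in s, forall y, vsval (e' y) = e y} by move=> y ys; rewrite vsprojK ?eU.
have e's (t : seq I) : {subset t <= s} -> map vsval (map e' t) = map e t.
  by move=> ts; rewrite -map_comp; apply/eq_in_map => y /ts/e'K.
have chU : ch_eq (sub_module W) (fun m => \sum_(y <- s) fundamental R (d y) m).
  apply: (IH _ e').
    rewrite basisEdim; apply/andP; split.
      by apply/subvP => u _; rewrite -mem_span_vsval e's // subvsP.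
    by rewrite dimvf /dim /= -/U size_map -(size_map e) -(eqP (fr)).
  move=> s1 y s2 i sE; rewrite -mem_span_vsval e's => [|z zs]; last first.
    by rewrite sE mem_cat inE zs !orbT.
  have ys : y \in s by rewrite sE mem_cat mem_head orbT.
  rewrite linearB linearZ /= scalerN (sub_piE (U := W)) e'K //.
  by apply: (tri (x :: s1)); rewrite sE.
pose X := in_tuple (e x :: map e s).
have frX : free X by rewrite /= free_cons exU.
pose g : 'Hom(M, simple_module R (d x)) := linfun (coord X ord0 : M -> C^o).
have gx : g (e x) = 1.
  by rewrite lfunE; apply: (etrans (coord_free ord0 ord0 frX)).
have /subvP Ug : (U <= lker g)%VS.
  apply/span_subvP => _ /(nthP 0)[j js <-]; rewrite memv_ker lfunE.
  apply/eqP/(etrans (coord_free (lift ord0 (Ordinal js)) ord0 frX)).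
  by rewrite eq_sym (negPf (neq_lift _ _)).
have decomp v : v - g v *: e x \in U.
  have vX : v \in <<X>>%VS by rewrite (eqP (andP bas).1) memvf.
  rewrite {1}(coord_span vX) big_ord_recl /= lfunE /= addrC addKr.
  apply: memv_suml => j _; apply/memvZ/memv_span/mem_nth.
  by have := ltn_ord j.
have gU v : (g v == 0) = (v \in U).
  apply/idP/idP => [/eqP gv|/Ug]; last by rewrite memv_ker.
  by have := decomp v; rewrite gv scale0r subr0.
have gpi i v : g (hm_pi M i v) = simple_pi R (d x) i (g v).
  have g0 u : u \in U -> g u = 0 by rewrite -gU => /eqP.
  have [u uU vE] : exists2 u, u \in U & v = u + g v *: e x.
    by exists (v - g v *: e x); rewrite ?subrK.
  rewrite {1}vE linearD linearZ /= linearD linearZ /= (g0 _ (US i u uU)) add0r.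
  have := g0 _ (tri [::] x s i erefl).
  rewrite linearB linearZ /= gx => /subr0_eq ->; rewrite /simple_pi.
  case: (i \in _); first by rewrite /= zero_lfunE scale0r scaler0.
  by rewrite /= id_lfunE scale1r [LHS]mulr1.
have kerg : lker g = U by apply/vspaceP => v; rewrite memv_ker gU.
have ex : short_exact (sub_module W) M (simple_module R (d x)).
  exists (linfun (vsval : sub_module W -> M)), g; split=> //.
  - move=> i v; apply: etrans (lfunE _ _) (etrans (sub_piE (U := W) i v) _).
    by rewrite lfunE.
  - apply/eqP/lker0P => u v; rewrite !lfunE; exact: subvs_inj.
  - rewrite kerg; apply/vspaceP => v; apply/memv_imgP/idP => [[u _ ->]|vU].
      by rewrite lfunE; exact: subvsP.
    by exists (vsproj U v); rewrite ?memvf // lfunE /= vsprojK.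
  - apply/vspaceP => c; rewrite memvf; apply/memv_imgP.
    by exists (c *: e x); rewrite ?memvf // linearZ /= gx [_ *: _]mulr1.
rewrite (_ : (fun m => _) =
    fun m => (\sum_(y <- s) fundamental R (d y) m) + fundamental R (d x) m).
  exact: ch_eq_exact ex chU (ch_eq_simple R (d x)).
by apply: funext => m; rewrite big_cons addrC.
Qed.
End Flags.

(** Rearrangement inequality for one exchange: the larger value moves to the larger index. *)
Lemma sum_swap_lt n (lo hi : 'I_n) (u v : 'I_n -> nat) :
    lo < hi -> u hi < u lo -> v lo = u hi -> v hi = u lo ->
    (forall k, k != lo -> k != hi -> v k = u k) ->
  \sum_(k < n) k * u k < \sum_(k < n) k * v k.
Proof.
move=> lh uu vlo vhi vu; have hl : hi != lo by rewrite -val_eqE /= gtn_eqF.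
rewrite !(bigD1 lo (P := predT)) //= !(bigD1 hi (P := fun k => k != lo)) //=.
rewrite vlo vhi [in ltnRHS](eq_bigr (fun k : 'I_n => k * u k)) => [|k /andP[]]; last first.
  by move=> kl kh; rewrite vu.
by rewrite !addnA ltn_add2r; nia.
Qed.

(** * Filtrations of [X_module] by levels of tableaux *)

Section Levels.
Local Open Scope ring_scope.
Variables (R : realType) (n : nat) (a : intcomp n).
Local Notation C := (complex R).
Local Notation M := (X_module R a).
Local Notation e T := (SET_basis R (Some T)).

Definition eval_at (T : SET a) (v : {ffun SET a -> C^o}) : C^o := v T.

Fact eval_at_linear T : linear (eval_at T).
Proof. by move=> c u v; rewrite /eval_at !ffunE. Qed.

HB.instance Definition _ T :=
  GRing.isLinear.Build C {ffun SET a -> C^o} C^o _ (eval_at T) (eval_at_linear T).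

Lemma eval_basis (T S : SET a) : eval_at S (e T) = (T == S)%:R.
Proof. by rewrite /eval_at ffunE (inj_eq Some_inj). Qed.

Variable lv : SET a -> nat.
Hypothesis lv_pi : forall i T T', SET_pi i T = Some T' -> (lv T' <= lv T)%N.

Definition level_space (k : nat) : {vspace M} :=
  <<[seq e T | T <- index_enum (SET a) & (lv T < k)%N]>>%VS.

Lemma mem_level_basis k (T : SET a) : (lv T < k)%N -> e T \in level_space k.
Proof. by move=> Tk; apply/memv_span/map_f; rewrite mem_filter Tk mem_index_enum. Qed.

Lemma level_spaceP k (v : M) :
  reflect (forall T, (k <= lv T)%N -> eval_at T v = 0) (v \in level_space k).
Proof.
apply: (iffP idP) => [vk T kT|v0].
  have /subvP/(_ v vk) : (level_space k <= lker (linfun (eval_at T)))%VS.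
    apply/span_subvP => u /mapP[S]; rewrite mem_filter => /andP[Sk _] ->.
    rewrite memv_ker lfunE /= eval_basis; have [ST|_] := eqVneq S T; last exact: eqxx.
    by move: kT; rewrite -ST leqNgt Sk.
  by rewrite memv_ker lfunE => /eqP.
rewrite (SET_basisE v); apply: memv_suml => T _.
have [kT|Tk] := leqP k (lv T); last exact/memvZ/mem_level_basis.
by have := v0 _ kT; rewrite /eval_at => ->; rewrite scale0r mem0v.
Qed.

Lemma level_space_stable k i (v : M) :
  v \in level_space k -> hm_pi M i v \in level_space k.
Proof.
move=> vk; suff /subvP sub : (hm_pi M i @: level_space k <= level_space k)%VS.
  exact/sub/memv_img.
rewrite limg_span; apply/span_subvP => u /mapP[w /mapP[T]].
rewrite mem_filter => /andP[Tk _] -> ->; rewrite /= X_pi_basis /=.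
case TE : (SET_pi i T) => [T'|]; first exact/mem_level_basis/(leq_ltn_trans (lv_pi TE)).
by rewrite (_ : SET_basis _ _ = 0) ?mem0v //; apply/ffunP => S; rewrite !ffunE.
Qed.

Definition level_module k := Submodule (@level_space_stable k).

(** Grows strictly with every swap made by [SET_pi], so sorting by it makes the action
    triangular. *)
Definition column_weight (T : SET a) := (\sum_(k < n) k * entry_col (val T) k)%N.

Lemma SET_pi_swap i (T T' : SET a) : SET_pi i T = Some T' ->
    (entry_col (val T) (entry_hi i) < entry_col (val T) (entry_lo i))%N ->
  val T' = swap_entries i (val T).
Proof.
move=> TE lt; have := filling_pi_SET i T; rewrite TE /filling_pi /=.
by case: ltngtP lt => // _ _ [].
Qed.

Lemma column_weight_pi i (T T' : SET a) : SET_pi i T = Some T' ->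
    (entry_col (val T) (entry_hi i) < entry_col (val T) (entry_lo i))%N ->
  (column_weight T < column_weight T')%N.
Proof.
move=> TE lt; rewrite /column_weight (SET_pi_swap TE lt).
apply: (sum_swap_lt (lo := entry_lo i) (hi := entry_hi i)) => // [||k kl kh].
- by rewrite entry_col_swap tpermL.
- by rewrite entry_col_swap tpermR.
- by rewrite entry_col_swap tpermD // eq_sym.
Qed.

Section Factor.
Variable k : nat.

Local Notation U := (level_module k.+1).
Local Notation W := (level_module k).
Local Notation FM := (factor_module U W).

Definition level_class :=
  sort (relpre column_weight leq) [seq T <- index_enum (SET a) | lv T == k].

(** The class of [v] in the factor module when [v] lies in [level_space k.+1]; for other [v] the
    value depends on the projection [vsproj]. *)
Definition to_factor (v : M) : FM :=
  quot_map (Submodule (@restrict_stable _ _ _ U W)) (vsproj U v).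

Lemma to_factor_eq0 v : v \in level_space k.+1 ->
  (to_factor v == 0) = (v \in level_space k).
Proof. by move=> vU; rewrite quot_map_eq0 mem_restrict_space vsprojK. Qed.

Lemma to_factor_pi i v : v \in level_space k.+1 ->
  hm_pi FM i (to_factor v) = to_factor (hm_pi M i v).
Proof.
move=> vU; rewrite /to_factor -[LHS]quot_map_hom; congr (quot_map _ _).
by apply: subvs_inj; rewrite (sub_piE (U := U)) !vsprojK ?level_space_stable.
Qed.

Lemma mem_level_class T : (T \in level_class) = (lv T == k).
Proof. by rewrite mem_sort mem_filter mem_index_enum andbT. Qed.

Lemma level_class_uniq : uniq level_class.
Proof. by rewrite sort_uniq filter_uniq // index_enum_uniq. Qed.

Lemma level_class_basis T : T \in level_class -> e T \in level_space k.+1.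
Proof. by rewrite mem_level_class => /eqP Tk; rewrite mem_level_basis ?Tk. Qed.

Lemma to_factor_sum (I : Type) (s : seq I) (c : I -> C) (v : I -> M) :
  to_factor (\sum_(j <- s) c j *: v j) = \sum_(j <- s) c j *: to_factor (v j).
Proof.
rewrite /to_factor linear_sum linear_sum; apply: eq_bigr => j _.
by rewrite linearZ linearZ.
Qed.

Lemma basis_level_class :
  basis_of fullv [seq to_factor (e T) | T <- level_class].
Proof.
apply/andP; split.
  apply/eqP/vspaceP => u; rewrite memvf.
  have: u \in limg (quot_map (Submodule (@restrict_stable _ _ _ U W))).
    by rewrite limg_quot_map memvf.
  move=> /memv_imgP[y _ ->]; have -> : y = vsproj U (vsval y) by rewrite vsvalK.
  rewrite -/(to_factor (vsval y)) (SET_basisE (vsval y)) to_factor_sum.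
  (* Coordinates above level [k] vanish on [y], and basis vectors below level [k] vanish in the
     factor. *)
  apply: memv_suml => T _; have [Tk|kT] := ltnP k (lv T).
    have := subvsP y; move/level_spaceP/(_ T Tk); rewrite /eval_at => ->.
    by rewrite scale0r mem0v.
  apply: memvZ; have [Tk|kT'] := ltnP (lv T) k.
    by rewrite (eqP (_ : to_factor (e T) == 0)) ?mem0v // to_factor_eq0 mem_level_basis.
  by apply/memv_span/map_f; rewrite mem_level_class eqn_leq kT kT'.
(* A dependence of the class of [e T] on those of the other vectors would put some [e T - v] into
   [level_space k], although its coordinate at [T] is 1. *)
suff fr s : uniq s -> {subset s <= level_class} -> free [seq to_factor (e T) | T <- s].
  exact: fr level_class_uniq _.
elim: s => [|T s IH] /= => [_ _|/andP[Ts us] sub]; first exact: nil_free.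
have sub' S : S \in s -> S \in level_class by move=> Ss; apply: sub; rewrite inE Ss orbT.
rewrite free_cons (IH us sub') andbT.
pose f := (quot_map (Submodule (@restrict_stable _ _ _ U W)) \o linfun (vsproj U))%VF.
have fE v : f v = to_factor v by rewrite comp_lfunE; congr (quot_map _ _); exact: lfunE.
have -> : [seq to_factor (e y) | y <- s] = map f [seq e y | y <- s].
  by rewrite -map_comp; apply/eq_map => S; rewrite /= fE.
rewrite -limg_span -fE; apply/memv_imgP => -[v vs] /eqP.
have fB : f (e T - v) = f (e T) - f v by rewrite linearB.
rewrite -subr_eq0 -fB fE.
have /subvP s_level : (<<[seq e y | y <- s]>> <= level_space k.+1)%VS.
  apply/span_subvP => _ /mapP[S Ss ->].
  exact/level_class_basis/sub'.
have eTk : e T \in level_space k.+1 by rewrite level_class_basis // sub ?mem_head.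
rewrite to_factor_eq0 => [/level_spaceP/(_ T)|]; last exact/memvB/s_level.
have Tk : lv T = k by apply/eqP; rewrite -mem_level_class sub ?mem_head.
have /subvP v0 : (<<[seq e y | y <- s]>> <= lker (linfun (eval_at T)))%VS.
  apply/span_subvP => _ /mapP[S Ss ->]; rewrite memv_ker lfunE /= eval_basis.
  have [ST|_] := eqVneq S T; last exact: eqxx.
  by move: Ts; rewrite -ST Ss.
have := v0 _ vs; rewrite memv_ker lfunE /= Tk leqnn => /eqP ev /(_ isT).
by rewrite linearB /= eval_basis eqxx ev subr0 => /eqP; rewrite oner_eq0.
Qed.

Lemma ch_level : ch_eq FM
  (fun m => \sum_(T : SET a | lv T == k) fundamental R (Defs.comp (Des (val T))) m).
Proof.
rewrite (_ : (fun m => _) = fun m =>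
    \sum_(T <- level_class) fundamental R (Defs.comp (Des (val T))) m); last first.
  by apply: funext => m; rewrite -big_filter; apply/perm_big; rewrite perm_sym perm_sort.
apply: ch_eq_flag basis_level_class _ => s1 T s2 i sE.
have Tcl : T \in level_class by rewrite sE mem_cat mem_head orbT.
(* By [compK] the diagonal coefficient is 0 at descents and 1 elsewhere; the cases are those of
   [filling_pi]. *)
rewrite to_factor_pi ?level_class_basis // /= X_pi_basis /= compK inE.
have := filling_pi_SET i T; rewrite /filling_pi.
case PT : (SET_pi i T) => [T'|] /=; last first.
  case: ltngtP => // _ _; rewrite scale0r subr0.
  rewrite (_ : SET_basis _ _ = 0); last by apply/ffunP => S; rewrite !ffunE.
  by rewrite /to_factor !linear0 mem0v.
case: ltngtP => //= [_ [] /val_inj ->|cols _]; first by rewrite scale1r subrr mem0v.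
rewrite scale0r subr0; have lt := column_weight_pi PT cols.
(* A swap to a lower level is zero in the factor; otherwise [T'] stays in the class and, being
   heavier, comes after [T]. *)
have [T'k|kT'] := ltnP (lv T') k.
  by rewrite (eqP (_ : to_factor (e T') == 0)) ?mem0v // to_factor_eq0 mem_level_basis // ltnW.
have T'cl : T' \in level_class.
  rewrite mem_level_class eqn_leq kT' andbT (leq_trans (lv_pi PT)) //.
  by rewrite leq_eqVlt -mem_level_class Tcl.
apply/memv_span/map_f; move: T'cl; rewrite sE mem_cat inE.
have srt : pairwise (relpre column_weight leq) level_class.
  rewrite -sorted_pairwise ?sort_sorted // => [x y|y x z] /=.
    exact: leq_total.
  exact: leq_trans.
case/or3P => // [T's1|/eqP TT]; last by rewrite TT ltnn in lt.
move: srt; rewrite sE pairwise_cat => /and3P[/allrelP/(_ _ _ T's1 (mem_head _ _))] /=.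
by rewrite leqNgt lt.
Qed.

End Factor.

Lemma level_filtration (I : Type) (B : I -> fps R) l :
    (forall T, (lv T < l)%N) -> (forall k, (k < l)%N -> exists T, lv T = k) ->
    (forall k, (k < l)%N -> exists b, B b =
       fun m => \sum_(T : SET a | lv T == k) fundamental R (Defs.comp (Des (val T))) m) ->
  distinguished_filtration M B.
Proof.
move=> lvl lv_onto lv_ch; exists l, level_module; split.
- apply/eqP; rewrite -subv0; apply/span_subvP => u /mapP[T].
  by rewrite mem_filter ltn0.
- apply/vspaceP => v; rewrite memvf; apply/level_spaceP => T lT.
  by move: (lvl T); rewrite ltnNge lT.
move=> k kl; split.
- apply: sub_span => u /mapP[T]; rewrite mem_filter => /andP[Tk _] ->.
  by apply: map_f; rewrite mem_filter ltnS (ltnW Tk) mem_index_enum.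
- have [T Tk] := lv_onto k kl; apply/eqP => kk.
  have: e T \in level_space k by rewrite [level_space k]kk mem_level_basis // Tk.
  move/level_spaceP/(_ T); rewrite Tk leqnn eval_basis eqxx => /(_ isT)/eqP.
  by rewrite oner_eq0.
- have [b bE] := lv_ch k kl; exists b; rewrite bE; exact: ch_level.
Qed.

End Levels.

Theorem theorem4p10 (R : realType) (n : nat) (a : intcomp n)
    (a_shuffle : exists (lam : seq nat) (k : nat),
       is_part lam /\ is_shuffle lam (nseq k 1) a) :
  distinguished_filtration (X_module R a) (@young_qschur R n).
Proof.
have [lam [k0 [lam_part lam_a]]] := a_shuffle.
have dec := shuffle_hook_decreasing lam_part lam_a.
have [sh shP] := fin_all_exists (fun T : SET a => SET_SYCT (valP T)).
pose heavier (x y : seq nat) := weight n y <= weight n x.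
(* Heaviest shapes come first, so a swap never raises the position in [L]. Using positions rather
   than weights as levels separates shapes of equal weight. *)
pose L := sort heavier (undup [seq intcomp_val (sh T) | T <- index_enum (SET a)]).
have shL T : intcomp_val (sh T) \in L.
  by rewrite mem_sort mem_undup map_f // mem_index_enum.
have uL : uniq L by rewrite sort_uniq undup_uniq.
have sL : sorted heavier L by apply: sort_sorted => x y; apply: leq_total.
have htr : transitive heavier by move=> y x z xy yz; apply: leq_trans yz xy.
pose lv T := index (intcomp_val (sh T)) L.
have lv_pi i (T T' : SET a) : SET_pi i T = Some T' -> lv T' <= lv T.
  move=> TE; have [TT|lt] := leqP (entry_col (val T) (entry_lo i)) (entry_col (val T) (entry_hi i)).
    have := filling_pi_SET i T; rewrite TE /filling_pi.
    by case: ltngtP TT => // _ _ [/val_inj ->].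
  have [U [sU TU]] := shP T; have [U' [sU' TU']] := shP T'.
  rewrite (SET_pi_swap TE lt) in TU'.
  have [wlt|eq] := SYCT_swap lt sU TU sU' TU'; last by rewrite /lv eq.
  rewrite leqNgt; apply/negP => /(sorted_ltn_index htr sL _ _ (shL _) (shL _)).
  by rewrite /heavier leqNgt wlt.
apply: (level_filtration lv_pi (l := size L)) => [T|k kL|k kL].
- by rewrite index_mem shL.
- have := mem_nth [::] kL; rewrite mem_sort mem_undup => /mapP[T _ TE].
  by exists T; rewrite /lv -TE index_uniq.
have := mem_nth [::] kL; rewrite mem_sort mem_undup => /mapP[T0 _ T0E].
have lvE T : (lv T == k) = (intcomp_val (sh T) == sh T0).
  apply/eqP/eqP => [Tk|TT0]; last by rewrite /lv TT0 -T0E index_uniq.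
  by rewrite -T0E -Tk nth_index.
have [U0 [sU0 TU0]] := shP T0.
exists (sh T0); apply: funext => m.
(* [u] sends the tableaux of this level to SYCT(sh T0) and [v] goes back, both keeping columns; [U0]
   and [T0] are mere default values. *)
have uP T : exists U : filling n (sh T0),
    lv T == k -> is_SYCT U /\ same_columns (val T) U.
  have [Tk|_] := boolP (lv T == k); last by exists U0.
  have := shP T; move: Tk; rewrite lvE => /eqP/intcomp_inj -> [U UP]; by exists U.
have [u {}uP] := fin_all_exists uP.
have vP (U : filling n (sh T0)) : exists T : SET a,
    is_SYCT U -> lv T == k /\ same_columns (val T) U.
  have [sU|_] := boolP (is_SYCT U); last by exists T0.
  have [T' [sT' TU']] := SYCT_SET dec (valP T0) sU0 TU0 sU.
  exists (MkSET sT') => _; split=> //; rewrite lvE.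
  have [U' [sU' TU'']] := shP (MkSET sT').
  apply/eqP; congr intcomp_val; apply: (SYCT_shape sU' sU) => i.
  by rewrite -TU'' TU'.
have [v {}vP] := fin_all_exists vP.
(* Columns determine a tableau within either family, so [u] and [v] are mutually inverse; they also
   determine the descents, so the summands agree. *)
rewrite /young_qschur (reindex_onto u v) => [|U sU]; last first.
  have [vk vU] := vP U sU; have [su vu] := uP _ vk.
  by apply: SYCT_same_columns => // i; rewrite -vu vU.
apply: eq_big => [T|T /andP[sU /eqP vu]].
  apply/andP/idP => [[sU /eqP <-]|Tk]; first by have [] := vP _ sU.
  have [sU TU] := uP _ Tk; split=> //; have [_ vU] := vP _ sU.
  apply/eqP/val_inj/SET_same_columns; rewrite ?(valP (v _)) ?(valP T) // => i.
  by rewrite vU TU.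
congr (fundamental R (Defs.comp _) m); have [_ vU] := vP _ sU.
by apply/setP => i; rewrite !inE -!vU vu.
Qed.
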